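(* Let $P$ be a finite poset, $\Bbbk$ a field, $n\ge1$, and let $R\subseteq[n]\times P$ be nonempty, with $r=|R|$. The Betti polynomial $$\beta(R,t)=t^r\beta_{0,R}+t^{r-1}\beta_{1,R}+\cdots+t\,\beta_{r-1,R},\qquad \beta_{i,R}=\beta_{i,R}(L(n,P)),$$ of $L(n,P)$ in multidegree $R$ is $$\beta(R,t)=t^n\prod_{i=1}^{n-1}\widetilde{H}(X_i(R),t).$$
   Context: $[n]=\{1<\dots<n\}$. The $n$'th letterplace ideal $L(n,P)$ is the ideal in $S=\Bbbk[x_{i,p}:(i,p)\in[n]\times P]$ generated by the monomials $x_{1,p_1}x_{2,p_2}\cdots x_{n,p_n}$ with $p_1\le p_2\le\cdots\le p_n$ in $P$. For $R\subseteq[n]\times P$, $\beta_{i,R}(L(n,P))=\dim_\Bbbk\mathrm{Tor}_i^S(L(n,P),\Bbbk)_R$, where the multidegree $R$ means the $0/1$ exponent vector with support $R$. Write $R=\bigcup_{i=1}^n\{i\}\times R_i$ with $R_i\subseteq P$, and let $\max(R_i)$, $\min(R_i)$ be the sets of maximal, respectively minimal, elements of $R_i$ with the order induced from $P$. For $i=1,\dots,n-1$, $X_i(R)$ is the simplicial complex on the vertex set $\{i\}\times\max(R_i)\cup\{i+1\}\times\min(R_{i+1})$ whose Stanley-Reisner ideal is the edge ideal of the bipartite graph with an edge between $(i,p)$ and $(i+1,q)$ iff $p\le q$ in $P$ (faces: vertex sets containing no edge). For a simplicial complex $X$, $\widetilde{H}(X,t)=\sum_{i\ge-1}t^i\dim_\Bbbk\widetilde{H}^i(X,\Bbbk)$,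 with $\widetilde H^{-1}(\{\emptyset\},\Bbbk)=\Bbbk$. *)

(* Defs.v *)
From HB Require Import structures.
From mathcomp Require Import all_boot all_order all_algebra.
From mathcomp Require Import fraction finmap monalg.

Set Implicit Arguments.
Unset Strict Implicit.
Unset Printing Implicit Defensive.

Import Order.TTheory GRing.Theory.

Local Open Scope ring_scope.

(* A complex C' --f--> C --g--> C'' of finite-dimensional vector spaces, in the
   row-vector convention (v |-> v *m f), has middle homology
   Ker(v |-> v *m g) / Im(w |-> w *m f). *)
Definition homology_dim (K : fieldType) (l m n : nat)
    (f : 'M[K]_(l, m)) (g : 'M[K]_(m, n)) : nat :=
  (\rank (kermx g) - \rank f)%N.

(* The polynomial ring S = K[x_v : v in V]. *)
Notation polyring K V := {malg K[{cmonom V}]}.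

(* A resolution  ... -> F_1 -> F_0 -> I -> 0  of an ideal I of S by free
   N^V-graded S-modules of finite rank.  F_i has a homogeneous basis
   (e_j)_{j < rank i}, with e_j of multidegree mfr_deg i j; row j of mfr_diff i
   (resp. mfr_aug) is the image of e_j.  Homogeneity of degree 0 says that every
   monomial of the coefficient of e_l in the image of e_j has degree
   deg e_j - deg e_l. *)
Record mgfree_resolution (K : fieldType) (V : finType)
    (I : polyring K V -> Prop) := MGFreeResolution {
  mfr_rank : nat -> nat;
  mfr_deg  : forall i, 'I_(mfr_rank i) -> {cmonom V};
  mfr_diff : forall i, 'M[polyring K V]_(mfr_rank i.+1, mfr_rank i);
  mfr_aug  : 'cV[polyring K V]_(mfr_rank 0);
  mfr_diff_homog : forall i j l (m : {cmonom V}),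
    (mfr_diff i j l)@_m != 0 -> mmul m (mfr_deg l) = mfr_deg j;
  mfr_aug_homog : forall j (m : {cmonom V}),
    (mfr_aug j 0)@_m != 0 -> m = mfr_deg j;
  mfr_aug_onto : forall f : polyring K V,
    I f <-> exists v : 'rV_(mfr_rank 0), f = (v *m mfr_aug) 0 0;
  mfr_exact0 : forall v : 'rV_(mfr_rank 0),
    v *m mfr_aug = 0 <-> exists w, v = w *m mfr_diff 0;
  mfr_exactS : forall i (v : 'rV_(mfr_rank i.+1)),
    v *m mfr_diff i = 0 <-> exists w, v = w *m mfr_diff i.+1
}.

Section Tor.
Variables (K : fieldType) (V : finType) (I : polyring K V -> Prop).
Variable F : mgfree_resolution I.

(* (F_i (x)_S K)_u has basis the e_j (x) 1 with e_j of multidegree u. *)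
Definition mfr_gens (i : nat) (u : {cmonom V}) : {set 'I_(mfr_rank F i)} :=
  [set j | mfr_deg j == u].

(* (d_i (x)_S K)_u: as K = S/(x_v : v in V), only constant coefficients
   survive. *)
Definition tor_diff (i : nat) (u : {cmonom V}) :
    'M[K]_(#|mfr_gens i.+1 u|, #|mfr_gens i u|) :=
  \matrix_(a, b) (mfr_diff F i (enum_val a) (enum_val b))@_mone.

(* dim_K Tor_i^S(I, K)_u = dim_K H_i(F (x)_S K)_u *)
Definition betti (i : nat) (u : {cmonom V}) : nat :=
  if i is i'.+1 then homology_dim (tor_diff i'.+1 u) (tor_diff i' u)
  else homology_dim (tor_diff 0 u) (0 : 'M[K]_(_, 0)).

End Tor.

Definition supp_deg (V : finType) (R : {set V}) : {cmonom V} :=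
  \big[mmul/mone]_(v in R) ucm v.

Section Letterplace.
Variables (K : fieldType) (d : Order.disp_t) (P : finPOrderType d) (n : nat).

(* x_{1,p_1} ... x_{n,p_n}; the index i in [n] is encoded as i - 1 : 'I_n. *)
Definition letterplace_gen (p : n.-tuple P) : polyring K ('I_n * P)%type :=
  \prod_(i < n) << ucm (i, tnth p i) >>.

Definition letterplace (f : polyring K ('I_n * P)%type) : Prop :=
  exists c : n.-tuple P -> polyring K ('I_n * P)%type,
    f = \sum_(p : n.-tuple P | sorted <=%O p) c p * letterplace_gen p.

End Letterplace.

Section ReducedCohomology.
Variables (K : fieldType) (V : finType) (X : {set {set V}}).

(* The faces of dimension k - 1. *)
Definition faces (k : nat) : {set {set V}} := [set s in X | #|s| == k].

(* C^(k-1)(X, K) -> C^k(X, K); vertices are ordered by their enumeration. *)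
Definition coboundary (k : nat) : 'M[K]_(#|faces k|, #|faces k.+1|) :=
  \matrix_(a, b)
    let s : {set V} := enum_val a in let t : {set V} := enum_val b in
    \sum_(v in t | t :\ v == s)
      (-1) ^+ #|[set w in t | (enum_rank w < enum_rank v)%N]|.

(* The dimension of the reduced cohomology of X in degree k - 1. *)
Definition rcoh_dim (k : nat) : nat :=
  if k is k'.+1 then homology_dim (coboundary k') (coboundary k'.+1)
  else homology_dim (0 : 'M[K]_(0, _)) (coboundary 0).

End ReducedCohomology.

(* Laurent polynomials in t are taken in the field Q(t). *)
Definition tvar : {fraction {poly rat}} := tofrac 'X.

Definition rcoh_series (K : fieldType) (V : finType) (X : {set {set V}}) :
    {fraction {poly rat}} :=
  \sum_(k < #|V|.+1) tvar ^ (k%:Z - 1) * (rcoh_dim K X k)%:R.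

Definition betti_poly (K : fieldType) (V : finType) (I : polyring K V -> Prop)
    (F : mgfree_resolution I) (R : {set V}) : {fraction {poly rat}} :=
  \sum_(i < #|R|) tvar ^+ (#|R| - i) * (betti F i (supp_deg R))%:R.

Section XComplex.
Variables (d : Order.disp_t) (P : finPOrderType d) (n : nat).
Implicit Types (A : {set P}) (R : {set 'I_n * P}).

Definition max_elts A : {set P} := [set p in A | [forall q in A, ~~ (p < q)%O]].
Definition min_elts A : {set P} := [set p in A | [forall q in A, ~~ (q < p)%O]].

Definition layer R (i : nat) : {set P} := [set v.2 | v in R & nat_of_ord v.1 == i].

Definition X_verts R (i : nat) : {set 'I_n * P} :=
  [set v | (nat_of_ord v.1 == i) && (v.2 \in max_elts (layer R i))
        || (nat_of_ord v.1 == i.+1) && (v.2 \in min_elts (layer R i.+1))].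

Definition X_edge (i : nat) (u v : 'I_n * P) : bool :=
  [&& nat_of_ord u.1 == i, nat_of_ord v.1 == i.+1 & (u.2 <= v.2)%O].

(* With the 0-based indexing of 'I_n, X_complex R i is the complex usually
   written X_{i+1}(R). *)
Definition X_complex R (i : nat) : {set {set 'I_n * P}} :=
  [set s : {set 'I_n * P} | (s \subset X_verts R i) &&
     [forall u in s, forall v in s, ~~ X_edge i u v]].

End XComplex.

(* Main.v *)
Require Import Defs.
From mathcomp Require Import all_boot all_order all_algebra.
From mathcomp Require Import fraction finmap monalg ring.

Set Implicit Arguments.
Unset Strict Implicit.
Unset Printing Implicit Defensive.

Import Order.TTheory GRing.Theory.

Local Open Scope ring_scope.

(** Fix a field K and a squarefree degree R.  A family S of subsets of the
    vertex set that is convex for inclusion carries a cochain complex: its basis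
    is S, and the differential adds a vertex, with the usual simplicial sign.
    Let h^k(S) be its cohomology in cardinality k.  The theorem compares two
    such computations.

    First, if U is the family of all s contained in R such that x^s lies in the
    ideal I, then beta_(i,R)(I) = h^(|R|-i)(U).  This is Hochster's formula, as U
    computes the cohomology of a simplex modulo a subcomplex.  For an arbitrary
    graded free resolution F of I, the elements of F of degree x^s form, for
    each s, an exact complex of vector spaces, augmented to K if s is in U and to
    0 otherwise.  Letting s vary over the subsets of R gives a double complex
    with basis the pairs (s, e_j) such that deg e_j divides x^s, and the pairs
    (s, augmentation) with s in U.  Its columns (s fixed) are exact, so it is
    exact.  The pairs (R, e_j) with deg e_j = x^R span a quotient, which is
    F (x) K in degree R.  In the complementary subcomplex the row of any e_j is a
    cube of sets, which is acyclic, so only the augmentation row U remains.  The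
    connecting isomorphism is the formula ([betti_coh_dim]).

    Second, for the letterplace ideal U consists of the s that contain a chain
    p_1 <= ... <= p_n with p_i in layer i ([letterplace_chain_sets]).  Write
    s = a + c with a in the first layer R_1 and c in the other layers, and let
    E(c) be the set of those p in R_1 that are the start of a chain continued in
    c; so s is in U iff a meets E(c).  If E(c) is not all of R_1, adding or
    removing a vertex of R_1 outside E(c) pairs off the sets with this c, and they
    contribute nothing.  What remains is the product of the nonempty subsets of
    R_1 with the c such that every element of R_1 starts a chain in c.  The same
    argument strips the layers off the second factor one after the other
    ([coh_poly_gated]), and the i-th layer contributes the family of the subsets b of
    R_(i+1) such that every element of R_i lies below some element of b.  The
    Kunneth formula ([coh_poly_join]) turns the product of families into a product
    of Poincare polynomials.  The factor of the nonempty subsets of R_1 is t.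

    Finally the family attached to layer i has the cohomology of X_i
    ([coh_poly_X]).  In X_i, group the faces by their part b in layer i+1: a
    vertex of max(R_i) without a neighbour in b can be added and removed freely,
    so only the faces b that dominate max(R_i) survive.  Elements of R_(i+1) that
    are not minimal, and elements of R_i that are not maximal, do not change the
    cohomology of the dominating family ([coh_poly_dominating_core],
    [dominating_core]).

    All complexes have a distinguished basis, and exact sequences are used only
    for subcomplexes spanned by basis elements; the pairing arguments are all
    instances of [toggle_exact]. *)

(** * Ranks of incidence matrices *)
Section IncidenceMatrix.
Variable K : fieldType.

Definition incmx (T1 T2 : finType) (D : T1 -> T2 -> K) (X : {set T1})
    (Y : {set T2}) : 'M[K]_(#|X|, #|Y|) :=
  \matrix_(a, b) D (enum_val a) (enum_val b).

(** The first matrix factors through the second one by two matrices that record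
    f and g, so neither map has to be injective. *)
Lemma rank_incmx_le (T1 T2 T1' T2' : finType) (D : T1 -> T2 -> K)
    (D' : T1' -> T2' -> K) (X : {set T1}) (Y : {set T2}) (X' : {set T1'})
    (Y' : {set T2'}) (f : T1 -> T1') (g : T2 -> T2')
    (sf : T1 -> K) (sg : T2 -> K) :
  (forall x, x \in X -> f x \in X') -> (forall y, y \in Y -> g y \in Y') ->
  (forall x y, x \in X -> y \in Y -> D x y = sf x * sg y * D' (f x) (g y)) ->
  (\rank (incmx D X Y) <= \rank (incmx D' X' Y'))%N.
Proof.
move=> fX gY eD.
pose A : 'M_(#|X|, #|X'|) :=
  \matrix_(a, b) (sf (enum_val a) * (f (enum_val a) == enum_val b)%:R).
pose B : 'M_(#|Y'|, #|Y|) :=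
  \matrix_(b, a) (sg (enum_val a) * (g (enum_val a) == enum_val b)%:R).
suff -> : incmx D X Y = A *m (incmx D' X' Y' *m B).
  exact: leq_trans (mxrankM_maxr _ _) (mxrankM_maxl _ _).
rewrite mulmxA; apply/matrixP => a b; rewrite [RHS]mxE.
have fa := fX _ (enum_valP a); have gb := gY _ (enum_valP b).
have AE c : (A *m incmx D' X' Y') a c =
    sf (enum_val a) * D' (f (enum_val a)) (enum_val c).
  rewrite mxE (bigD1 (enum_rank_in fa (f (enum_val a)))) //= !mxE.
  rewrite enum_rankK_in // eqxx mulr1 big1 ?addr0 // => i /eqP ni; rewrite !mxE.
  case: eqP => [e|_]; last by rewrite /= mulr0 mul0r.
  by case: ni; apply: enum_val_inj; rewrite enum_rankK_in.
under eq_bigr do rewrite AE mxE.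
rewrite (bigD1 (enum_rank_in gb (g (enum_val b)))) //= enum_rankK_in //.
rewrite eqxx mulr1 big1 => [|i /eqP ni].
  by rewrite addr0 mxE eD ?enum_valP // mulrAC.
case: eqP => [e|_]; last by rewrite /= !mulr0.
by case: ni; apply: enum_val_inj; rewrite enum_rankK_in.
Qed.

Lemma rank_incmx_imset (T1 T2 T1' T2' : finType) (D : T1 -> T2 -> K)
    (D' : T1' -> T2' -> K) (X : {set T1}) (Y : {set T2})
    (f : T1 -> T1') (g : T2 -> T2') (c : K) : c != 0 ->
  {in X &, injective f} -> {in Y &, injective g} ->
  (forall x y, x \in X -> y \in Y -> D' (f x) (g y) = c * D x y) ->
  \rank (incmx D X Y) = \rank (incmx D' (f @: X) (g @: Y)).
Proof.
move=> c0 fI gI eD; apply/eqP; rewrite eqn_leq; apply/andP; split.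
  apply: (rank_incmx_le (f := f) (g := g) (sf := fun=> c^-1) (sg := fun=> 1)).
  - by move=> x xX; apply: imset_f.
  - by move=> y yY; apply: imset_f.
  by move=> x y xX yY; rewrite mulr1 eD // mulKf.
have [->|[x0 x0X]] := set_0Vmem X.
  by apply: leq_trans (rank_leq_row _) _; rewrite imset0 cards0.
have [->|[y0 y0Y]] := set_0Vmem Y.
  by apply: leq_trans (rank_leq_col _) _; rewrite imset0 cards0.
pose f' x' := odflt x0 [pick x in X | f x == x'].
pose g' y' := odflt y0 [pick y in Y | g y == y'].
have fK x : x \in X -> f' (f x) = x.
  move=> xX; rewrite /f'; case: pickP => [y /andP[yX /eqP/fI->//]|/(_ x)].
  by rewrite xX eqxx.
have gK y : y \in Y -> g' (g y) = y.
  move=> yY; rewrite /g'; case: pickP => [x /andP[xY /eqP/gI->//]|/(_ y)].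
  by rewrite yY eqxx.
apply: (rank_incmx_le (f := f') (g := g') (sf := fun=> c) (sg := fun=> 1)).
- by move=> _ /imsetP[x xX ->]; rewrite fK.
- by move=> _ /imsetP[y yY ->]; rewrite gK.
by move=> _ _ /imsetP[x xX ->] /imsetP[y yY ->]; rewrite mulr1 fK // gK // eD.
Qed.

Lemma homology_dimE l m n (f : 'M[K]_(l, m)) (g : 'M[K]_(m, n)) :
  homology_dim f g = (m - \rank g - \rank f)%N.
Proof. by rewrite /homology_dim mxrank_ker. Qed.

End IncidenceMatrix.

(** * Complexes with a distinguished basis *)
Section BasedComplex.
Variables (K : fieldType) (T : finType) (D : T -> T -> K) (deg : T -> nat).
Hypothesis homog : forall x y, D x y != 0 -> deg y = (deg x).+1.
Implicit Types (S A : {set T}) (v w : T -> K) (k : nat).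

(** A cochain of S is given by a function on all of T, which is read on S only;
    restriction to a subset and extension from it are thus invisible. *)
Definition coapp S v (y : T) : K := \sum_(x in S) v x * D x y.

Definition is_complex S :=
  forall x z, x \in S -> z \in S -> \sum_(y in S) D x y * D y z = 0.

Definition cocycle S k v :=
  forall y, y \in S -> deg y = k.+1 -> coapp S v y = 0.

Definition cobound S k v :=
  exists w, forall y, y \in S -> deg y = k -> v y = coapp S w y.

Definition exact_at S k := forall v, cocycle S k v -> cobound S k v.

(** Cochains that represent a basis of the cohomology of S in degree k.  Maps of
    long exact sequences are applied to these representatives, which avoids
    quotient spaces; dimensions come in only afterwards. *)
Definition coh_basis S k (L : finType) (z : L -> T -> K) :=
  [/\ forall l, cocycle S k (z l),
      forall c : L -> K, cobound S k (fun x => \sum_l c l * z l x) ->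
        forall l, c l = 0
    & forall v, cocycle S k v ->
        exists c : L -> K, cobound S k (fun x => v x - \sum_l c l * z l x)].

(** The differential points forward, so the basis elements in a closed subset A
    span a subcomplex, and those in [S :\: A] the quotient. *)
Definition subcomplex A S :=
  A \subset S /\ forall x y, x \in A -> y \in S -> D x y != 0 -> y \in A.

Lemma coapp_ext S v w y :
  (forall x, x \in S -> (deg x).+1 = deg y -> v x = w x) ->
  coapp S v y = coapp S w y.
Proof.
move=> vw; apply: eq_bigr => x xS.
have [->|/homog e] := eqVneq (D x y) 0; first by rewrite !mulr0.
by rewrite vw.
Qed.

Lemma coapp_eq0 S v y :
  (forall x, x \in S -> (deg x).+1 = deg y -> v x = 0) -> coapp S v y = 0.
Proof.
move=> v0; rewrite (coapp_ext (w := fun=> 0)) //.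
by rewrite /coapp big1 // => x _; rewrite mul0r.
Qed.

Lemma coappN S v y : coapp S (fun x => - v x) y = - coapp S v y.
Proof. by rewrite /coapp -sumrN; apply: eq_bigr => x _; rewrite mulNr. Qed.

Lemma coappB S v w y :
  coapp S (fun x => v x - w x) y = coapp S v y - coapp S w y.
Proof. by rewrite /coapp -sumrB; apply: eq_bigr => x _; rewrite mulrBl. Qed.

Lemma coapp_sum S (L : finType) (c : L -> K) (z : L -> T -> K) y :
  coapp S (fun x => \sum_l c l * z l x) y = \sum_l c l * coapp S (z l) y.
Proof.
under [RHS]eq_bigr do rewrite mulr_sumr.
rewrite exchange_big; apply: eq_bigr => x _.
by rewrite mulr_suml; apply: eq_bigr => l _; rewrite mulrA.
Qed.

Lemma coapp_coapp S v z : is_complex S -> z \in S -> coapp S (coapp S v) z = 0.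
Proof.
move=> cS zS; rewrite /coapp; under eq_bigr do rewrite mulr_suml.
rewrite exchange_big big1 // => x xS.
under eq_bigr do rewrite -mulrA.
by rewrite -mulr_sumr cS ?mulr0.
Qed.

Section Split.
Variables S A : {set T}.
Hypothesis sAS : subcomplex A S.
Let Q := S :\: A.

Lemma sub_mem x : x \in A -> x \in S. Proof. exact: (subsetP sAS.1). Qed.

Lemma quo_mem x : x \in Q -> x \in S. Proof. by case/setDP. Qed.

Lemma quo_notin x : x \in Q -> x \notin A. Proof. by case/setDP. Qed.

Lemma mem_split x : x \in S -> (x \in A) || (x \in Q).
Proof. by rewrite inE => ->; rewrite andbT orbN. Qed.

Lemma sub_quo0 x y : x \in A -> y \in Q -> D x y = 0.
Proof.
move=> xA yQ; apply/eqP; apply: contraNT (quo_notin yQ).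
exact: sAS.2 (quo_mem yQ).
Qed.

Lemma coapp_split v y : coapp S v y = coapp A v y + coapp Q v y.
Proof.
rewrite /coapp (big_setID A); congr (_ + _).
by apply: eq_bigl => x; rewrite (setIidPr sAS.1).
Qed.

Lemma coapp_sub0 v y : y \in Q -> coapp A v y = 0.
Proof. by move=> yQ; apply: big1 => x xA; rewrite sub_quo0 ?mulr0. Qed.

Lemma coapp_quo v y : y \in Q -> coapp S v y = coapp Q v y.
Proof. by move=> yQ; rewrite coapp_split coapp_sub0 ?add0r. Qed.

Definition glue v w x := if x \in A then v x else w x.

Lemma coapp_glue v w y : coapp S (glue v w) y = coapp A v y + coapp Q w y.
Proof.
rewrite coapp_split; congr (_ + _); apply: eq_bigr => x xX; rewrite /glue.
  by rewrite xX.
by rewrite (negbTE (quo_notin xX)).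
Qed.

Lemma sum_split x z : \sum_(y in S) D x y * D y z =
  \sum_(y in A) D x y * D y z + \sum_(y in Q) D x y * D y z.
Proof. exact: (coapp_split (D x) z). Qed.

Lemma complex_sub : is_complex S -> is_complex A.
Proof.
move=> cS x z xA zA; rewrite -[RHS](cS _ _ (sub_mem xA) (sub_mem zA)) sum_split.
by rewrite [X in _ + X]big1 ?addr0 // => y yQ; rewrite sub_quo0 ?mul0r.
Qed.

Lemma complex_quo : is_complex S -> is_complex Q.
Proof.
move=> cS x z xQ zQ; rewrite -[RHS](cS _ _ (quo_mem xQ) (quo_mem zQ)) sum_split.
by rewrite [X in X + _]big1 ?add0r // => y yA; rewrite (sub_quo0 yA) ?mulr0.
Qed.

Hypothesis cS : is_complex S.

(** The component from the quotient to A of the square of the differential. *)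
Lemma coapp_connect v z : z \in A ->
  coapp A (coapp Q v) z = - coapp Q (coapp Q v) z.
Proof.
move=> zA; apply/eqP; rewrite -subr_eq0 opprK -coapp_split.
have := coapp_coapp (glue (fun=> 0) v) cS (sub_mem zA).
rewrite (coapp_ext (w := coapp Q v)) => [->//|x xS _].
by rewrite coapp_glue [coapp A _ _]big1 ?add0r // => i; rewrite mul0r.
Qed.

(** [coapp Q], read on A, is the connecting homomorphism. *)
Lemma connect_cocycle k v : cocycle Q k v -> cocycle A k.+1 (coapp Q v).
Proof.
move=> vQ y yA yk; rewrite coapp_connect //; apply/eqP; rewrite oppr_eq0.
apply/eqP; apply: coapp_eq0 => x xQ; rewrite yk => -[xk]; exact: vQ.
Qed.

(** A primitive in the quotient leaves an error supported on A, which has a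
    primitive there. *)
Lemma exact_split k : exact_at A k -> exact_at Q k -> exact_at S k.
Proof.
move=> eA eQ v vS.
have [|w vw] := eQ v.
  by move=> y yQ yk; rewrite -coapp_quo // vS // quo_mem.
pose v' x := v x - coapp Q w x.
have [|u v'u] := eA v'.
  move=> y yA yk; have yS := sub_mem yA.
  transitivity (coapp S v' y).
    rewrite coapp_split [X in _ + X]coapp_eq0 ?addr0 // => x xQ.
    by rewrite yk => -[xk]; rewrite /v' vw // subrr.
  rewrite /v' coappB vS // sub0r; apply/eqP; rewrite oppr_eq0; apply/eqP.
  by rewrite coapp_split coapp_connect // addNr.
exists (glue u w) => y yS yk; rewrite coapp_glue.
case/orP: (mem_split yS) => [yA|yQ].
  by rewrite -v'u // /v' subrK.
by rewrite vw // coapp_sub0 // add0r.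
Qed.

(** When the middle term is exact the connecting homomorphism is bijective.
    Exactness is required in two degrees only: a complex built from a truncated
    resolution is not exact at the truncation. *)
Lemma coh_basis_connect k (L : finType) (z : L -> T -> K) :
  exact_at S k -> exact_at S k.+1 -> coh_basis Q k z ->
  coh_basis A k.+1 (fun l => coapp Q (z l)).
Proof.
move=> eS eS' [zc zi zs]; split.
- by move=> l; apply: connect_cocycle.
- move=> c [w cw]; apply: zi.
  have [|u vu] := eS (glue (fun x => - w x) (fun x => \sum_l c l * z l x)).
    move=> y yS yk; rewrite coapp_glue coapp_sum.
    case/orP: (mem_split yS) => [yA|yQ].
      by rewrite coappN -cw // addNr.
    rewrite coapp_sub0 // add0r.
    by rewrite big1 // => l _; rewrite zc // mulr0.
  exists u => y yQ yk; rewrite -coapp_quo // -vu ?quo_mem //.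
  by rewrite /glue (negbTE (quo_notin yQ)).
move=> v vA; have [|u vu] := eS' (glue v (fun=> 0)).
  move=> y yS yk; rewrite coapp_glue [X in _ + X]coapp_eq0 // addr0.
  case/orP: (mem_split yS) => [yA|yQ]; first exact: vA.
  exact: coapp_sub0.
have [|c [w uw]] := zs u.
  move=> y yQ yk; rewrite -coapp_quo // -vu ?quo_mem //.
  by rewrite /glue (negbTE (quo_notin yQ)).
exists c, (fun x => u x - coapp Q w x) => y yA yk.
have -> : v y = coapp S u y by rewrite -vu ?sub_mem // /glue yA.
rewrite coapp_split -addrA coappB coapp_connect // opprK; congr (_ + _).
rewrite -coapp_sum -coappB; apply: coapp_ext => x xQ.
by rewrite yk => -[xk]; apply: uw.
Qed.

(** A cocycle of the quotient is lifted by solving for its boundary in A. *)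
Lemma coh_basis_quo k (L : finType) (z : L -> T -> K) :
  exact_at A k -> exact_at A k.+1 -> coh_basis S k z -> coh_basis Q k z.
Proof.
move=> eA eA' [zc zi zs]; split.
- by move=> l y yQ yk; rewrite -coapp_quo // zc // quo_mem.
- move=> c [w cw]; apply: zi.
  pose v x := \sum_l c l * z l x - coapp Q w x.
  have [|u vu] := eA v.
    move=> y yA yk; transitivity (coapp S v y).
      rewrite coapp_split [X in _ + X]coapp_eq0 ?addr0 // => x xQ.
      by rewrite yk => -[xk]; rewrite /v cw // subrr.
    rewrite /v coappB coapp_sum big1 => [|l _]; last first.
      by rewrite zc ?mulr0 // sub_mem.
    by rewrite sub0r coapp_split coapp_connect // addNr oppr0.
  exists (glue u w) => y yS yk; rewrite coapp_glue.
  case/orP: (mem_split yS) => [yA|yQ].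
    by rewrite -vu // /v subrK.
  by rewrite cw // coapp_sub0 // add0r.
move=> v vQ; have [u vu] := eA' _ (connect_cocycle vQ).
have [|c [w cw]] := zs (glue (fun x => - u x) v).
  move=> y yS yk; rewrite coapp_glue.
  case/orP: (mem_split yS) => [yA|yQ].
    by rewrite coappN -vu // addNr.
  by rewrite vQ // addr0 coapp_sub0.
exists c, w => y yQ yk; rewrite -coapp_quo // -cw ?quo_mem //.
by rewrite /glue (negbTE (quo_notin yQ)).
Qed.

(** A cocycle of S is moved into A by a primitive of its part in the
    quotient. *)
Lemma coh_basis_sub k (L : finType) (z : L -> T -> K) :
  (forall j, exact_at Q j) -> coh_basis A k z ->
  coh_basis S k (fun l => glue (z l) (fun=> 0)).
Proof.
move=> eQ [zc zi zs].
have sumA (c : L -> K) x : x \in A ->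
    \sum_l c l * glue (z l) (fun=> 0) x = \sum_l c l * z l x.
  by move=> xA; apply: eq_bigr => l _; rewrite /glue xA.
have sumQ (c : L -> K) x : x \in Q ->
    \sum_l c l * glue (z l) (fun=> 0) x = 0.
  move=> xQ; apply: big1 => l _.
  by rewrite /glue (negbTE (quo_notin xQ)) mulr0.
split.
- move=> l y yS yk; rewrite coapp_glue [X in _ + X]coapp_eq0 // addr0.
  case/orP: (mem_split yS) => [yA|yQ]; first exact: zc.
  exact: coapp_sub0.
- move=> c [w cw]; apply: zi.
  (* for k = 0 there is no degree below k in which w has to be corrected *)
  case: k zc zs cw => [|k] zc zs cw.
    exists w => y yA yk; rewrite -sumA // cw ?sub_mem //.
    by rewrite !coapp_eq0 // yk.
  have [|u wu] := eQ k w.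
    by move=> y yQ yk; rewrite -coapp_quo // -cw ?quo_mem // sumQ.
  exists (fun x => w x - coapp Q u x) => y yA yk.
  rewrite -sumA // cw ?sub_mem // coappB coapp_connect // opprK coapp_split.
  congr (_ + _); apply: coapp_ext => x xQ; rewrite yk => -[xk]; exact: wu.
move=> v vS; have [|u vu] := eQ k v.
  by move=> y yQ yk; rewrite -coapp_quo // vS // quo_mem.
pose v' x := v x - coapp Q u x.
have [|c [w cw]] := zs v'.
  move=> y yA yk; transitivity (coapp S v' y).
    rewrite coapp_split [X in _ + X]coapp_eq0 ?addr0 // => x xQ.
    by rewrite yk => -[xk]; rewrite /v' vu // subrr.
  rewrite coappB vS ?sub_mem // coapp_split coapp_connect //.
  by rewrite addNr subrr.
exists c, (glue w u) => y yS yk; rewrite coapp_glue.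
case/orP: (mem_split yS) => [yA|yQ].
  by rewrite sumA // -cw // /v' addrAC subrK.
by rewrite sumQ // subr0 vu // coapp_sub0 // add0r.
Qed.

End Split.
End BasedComplex.
(** * Dimensions of cohomology groups *)
Section Homology.
Variables (K : fieldType) (T : finType) (D : T -> T -> K) (deg : T -> nat).
Hypothesis homog : forall x y, D x y != 0 -> deg y = (deg x).+1.
Implicit Types (S A : {set T}) (v w : T -> K) (k : nat).

Local Notation is_complex := (is_complex D).
Local Notation cocycle := (cocycle D deg).
Local Notation cobound := (cobound D deg).
Local Notation exact_at := (exact_at D deg).
Local Notation coh_basis := (coh_basis D deg).

Definition level S k := [set x in S | deg x == k].
(** Degree k - 1, empty for k = 0. *)
Definition below S k := [set x in S | (deg x).+1 == k].

Definition coh_dim S k :=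
  homology_dim (incmx D (below S k) (level S k))
               (incmx D (level S k) (level S k.+1)).

Lemma coapp_below S k v y : deg y = k ->
  coapp D S v y = \sum_(x in below S k) v x * D x y.
Proof.
move=> yk; rewrite /coapp (bigID (fun x => (deg x).+1 == k)) /=.
rewrite [X in _ + X]big1 ?addr0.
  by apply: eq_bigl => x; rewrite inE.
move=> x /andP[_ xk]; apply/eqP; rewrite mulf_eq0; apply/orP; right.
by apply: contraNT xk => /homog; rewrite yk => ->.
Qed.

Lemma belowS S k : below S k.+1 = level S k.
Proof. by apply/setP => x; rewrite !inE eqSS. Qed.

Definition of_row S (u : 'rV[K]_#|S|) (x : T) : K :=
  \sum_a u 0 a * (enum_val a == x)%:R.

Lemma of_rowE S (u : 'rV[K]_#|S|) a : of_row u (enum_val a) = u 0 a.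
Proof.
rewrite /of_row (bigD1 a) //= eqxx mulr1 big1 ?addr0 // => b ba.
by rewrite (inj_eq enum_val_inj) (negbTE ba) mulr0.
Qed.

Definition to_row S v : 'rV[K]_#|S| := \row_a v (enum_val a).

Lemma to_row_mul S k v b :
  (to_row (level S k) v *m incmx D (level S k) (level S k.+1)) 0 b =
  coapp D S v (enum_val b).
Proof.
have := enum_valP b; rewrite inE => /andP[_ /eqP bk].
rewrite (coapp_below _ _ bk) belowS mxE.
under eq_bigr do rewrite !mxE.
by rewrite -(big_enum_val (fun x => v x * D x (enum_val b))).
Qed.

Lemma cocycleP S k v : cocycle S k v <->
  to_row (level S k) v *m incmx D (level S k) (level S k.+1) = 0.
Proof.
split=> [vS|v0 y yS yk].
  apply/rowP => b; rewrite to_row_mul mxE.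
  by have := enum_valP b; rewrite inE => /andP[bS /eqP bk]; apply: vS.
have yl : y \in level S k.+1 by rewrite inE yS yk eqxx.
by rewrite -(enum_rankK_in yl yl) -to_row_mul v0 mxE.
Qed.

Lemma coboundP S k v : cobound S k v <->
  (to_row (level S k) v <= incmx D (below S k) (level S k))%MS.
Proof.
have mulE (w : 'rV_#|below S k|) b :
    (w *m incmx D (below S k) (level S k)) 0 b =
    coapp D S (of_row w) (enum_val b).
  have := enum_valP b; rewrite inE => /andP[_ /eqP bk].
  rewrite (coapp_below _ _ bk) mxE [RHS]big_enum_val /=.
  by apply: eq_bigr => a _; rewrite of_rowE mxE.
split=> [[w vw]|/submxP[w vw]].
  apply/submxP; exists (to_row (below S k) w); apply/rowP => b.
  rewrite mulE mxE.
  have := enum_valP b; rewrite inE => /andP[bS /eqP bk].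
  rewrite vw //; apply: (coapp_ext homog) => x xS; rewrite bk => xk.
  have xb : x \in below S k by rewrite inE xS xk eqxx.
  by rewrite -(enum_rankK_in xb xb) of_rowE mxE.
exists (of_row w) => y yS yk.
have yl : y \in level S k by rewrite inE yS yk eqxx.
by rewrite -(enum_rankK_in yl yl) -mulE -vw mxE.
Qed.

(** A row basis of a complement of the coboundaries in the cocycles. *)
Lemma coh_basis_exists S k : is_complex S -> exists z : 'I_(coh_dim S k) -> T -> K,
  coh_basis S k z.
Proof.
move=> cS; rewrite /coh_dim /homology_dim.
set f := incmx _ (below S k) _; set g := incmx _ (level S k) (level S k.+1).
pose H := (kermx g :\: f)%MS.
have fg : (f <= kermx g)%MS.
  apply/sub_kermxP/matrixP => a b; rewrite !mxE.
  have := enum_valP a; rewrite inE => /andP[aS /eqP ak].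
  have := enum_valP b; rewrite inE => /andP[bS bk].
  rewrite -[RHS](cS _ _ aS bS) -[RHS]/(coapp D S (D (enum_val a)) (enum_val b)).
  rewrite (coapp_below _ _ (eqP bk)) belowS [RHS]big_enum_val.
  by apply: eq_bigr => c _; rewrite !mxE.
have -> : (\rank (kermx g) - \rank f)%N = \rank H.
  have := mxrank_cap_compl (kermx g) f.
  by rewrite (capmx_idPr fg) => <-; rewrite addKn.
pose z l := of_row (row l (row_base H)).
have zE (c : 'I_(\rank H) -> K) :
    to_row (level S k) (fun x => \sum_l c l * z l x) =
    (\row_l c l) *m row_base H.
  apply/rowP => a; rewrite !mxE; apply: eq_bigr => l _.
  by rewrite /z of_rowE !mxE.
exists z; split.
- move=> l; apply/cocycleP.
  have -> : to_row (level S k) (z l) = row l (row_base H).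
    by apply/rowP => a; rewrite !mxE /z of_rowE !mxE.
  apply/sub_kermxP/(submx_trans (row_sub _ _)).
  by rewrite eq_row_base diffmxSl.
- move=> c /coboundP; rewrite zE => cf l.
  have : ((\row_l c l) *m row_base H <= H :&: f)%MS.
    by rewrite sub_capmx cf andbT -(eq_row_base H) submxMl.
  rewrite capmx_diff submx0 => /eqP/(congr1 (mulmx^~ (pinvmx (row_base H)))).
  rewrite mul0mx mulmxKp ?row_base_free // => /rowP/(_ l).
  by rewrite !mxE.
move=> v /cocycleP/sub_kermxP.
rewrite -(addsmx_diff_cap_eq (kermx g) f) => /sub_addsmxP[[u1 u2] /= vE].
have : (u1 *m (kermx g :\: f)%MS <= row_base H)%MS.
  by rewrite eq_row_base submxMl.
case/submxP => c cE.
exists (fun l => c 0 l); apply/coboundP.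
have -> : to_row (level S k) (fun x => v x - \sum_l c 0 l * z l x) =
    to_row (level S k) v - c *m row_base H.
  apply/rowP => a; have /rowP/(_ a) := zE (fun l => c 0 l).
  rewrite !mxE => ->; congr (_ - _); apply: eq_bigr => l _.
  by rewrite mxE.
rewrite vE cE addrAC subrr add0r (submx_trans (submxMl _ _)) //.
exact: capmxSr.
Qed.

(** The coefficients of one family with respect to the other one form a matrix
    with independent rows. *)
Lemma coh_basis_card_le S k (L L' : finType) (z : L -> T -> K) (z' : L' -> T -> K) :
  coh_basis S k z -> coh_basis S k z' -> (#|L| <= #|L'|)%N.
Proof.
move=> [zc zi zs] [zc' zi' zs'].
have /fin_all_exists[a az] : forall l, exists c : L' -> K,
    cobound S k (fun x => z l x - \sum_l' c l' * z' l' x).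
  by move=> l; apply: zs'.
have /fin_all_exists[w wz] : forall l, exists w, forall y, y \in S ->
  deg y = k -> z l y - \sum_l' a l l' * z' l' y = coapp D S w y.
  by move=> l; apply: az.
pose A : 'M[K]_(#|L|, #|L'|) := \matrix_(i, j) a (enum_val i) (enum_val j).
suff /eqP <- : row_free A by apply: rank_leq_col.
apply: inj_row_free => c cA; apply/rowP => i; rewrite mxE.
have ca l' : \sum_l c 0 (enum_rank l) * a l l' = 0.
  have /rowP/(_ (enum_rank l')) := cA; rewrite !mxE => cAl; rewrite -[RHS]cAl.
  rewrite (reindex_onto (@enum_rank L) enum_val) /= => [|j _]; last by rewrite enum_valK.
  rewrite [RHS](eq_bigl xpredT) => [|l]; last by rewrite enum_rankK eqxx.
  by apply: eq_bigr => l _; rewrite mxE !enum_rankK.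
have := zi (fun l => c 0 (enum_rank l)) _ (enum_val i).
rewrite enum_valK; apply.
exists (fun x => \sum_l c 0 (enum_rank l) * w l x) => y yS yk.
rewrite coapp_sum; apply/eqP; rewrite -subr_eq0 -sumrB; apply/eqP.
transitivity (\sum_l \sum_l' c 0 (enum_rank l) * a l l' * z' l' y).
  apply: eq_bigr => l _; rewrite -wz // -mulrBr opprB addrC subrK mulr_sumr.
  by apply: eq_bigr => l' _; rewrite mulrA.
rewrite exchange_big big1 // => l' _.
by rewrite -mulr_suml ca mul0r.
Qed.

Lemma coh_basis_card S k (L : finType) (z : L -> T -> K) :
  is_complex S -> coh_basis S k z -> coh_dim S k = #|L|.
Proof.
move=> cS hz; have [z' hz'] := coh_basis_exists k cS.
have := coh_basis_card_le hz' hz; have := coh_basis_card_le hz hz'.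
by rewrite card_ord => le1 le2; apply/eqP; rewrite eqn_leq le2.
Qed.

Lemma coh_dim_exact S k : is_complex S -> exact_at S k -> coh_dim S k = 0%N.
Proof.
move=> cS eS; rewrite -card_void.
apply: (coh_basis_card (z := fun l : void => match l with end)) => //; split.
- by case.
- by move=> c _ [].
move=> v /eS[w vw]; exists (fun l : void => match l with end), w => y yS yk.
by rewrite big1 ?subr0 ?vw // => -[].
Qed.

Lemma coh_dim_connect S A k : is_complex S -> subcomplex D A S ->
  exact_at S k -> exact_at S k.+1 -> coh_dim (S :\: A) k = coh_dim A k.+1.
Proof.
move=> cS sA eS eS'.
have [z hz] := coh_basis_exists k (complex_quo sA cS).
rewrite (coh_basis_card (complex_sub sA cS) (coh_basis_connect homog sA cS eS eS' hz)).
by rewrite card_ord.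
Qed.

Lemma coh_dim_quo S A k : is_complex S -> subcomplex D A S ->
  exact_at A k -> exact_at A k.+1 -> coh_dim (S :\: A) k = coh_dim S k.
Proof.
move=> cS sA eS eS'.
have [z hz] := coh_basis_exists k cS.
rewrite (coh_basis_card (complex_quo sA cS) (coh_basis_quo homog sA cS eS eS' hz)).
by rewrite card_ord.
Qed.

Lemma coh_dim_sub S A k : is_complex S -> subcomplex D A S ->
  (forall j, exact_at (S :\: A) j) -> coh_dim A k = coh_dim S k.
Proof.
move=> cS sA eQ.
have [z hz] := coh_basis_exists k (complex_sub sA cS).
rewrite (coh_basis_card cS (coh_basis_sub homog sA cS eQ hz)).
by rewrite card_ord.
Qed.

(** The spectral sequence of a filtration, when its first page vanishes: a fibre
    with the largest value of rho is a subcomplex, and can be split off. *)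
Lemma exact_fibres (G : finType) (f : T -> G) (rho : G -> nat) S k :
  is_complex S ->
  (forall x y, x \in S -> y \in S -> D x y != 0 ->
     f x = f y \/ (rho (f x) < rho (f y))%N) ->
  (forall g, exact_at [set x in S | f x == g] k) -> exact_at S k.
Proof.
have [n] := ubnP #|S|; elim: n S => // n IH S Sn cS fS eS.
have [->|[x0 x0S]] := set_0Vmem S.
  by move=> v _; exists v => y; rewrite inE.
case: (@arg_maxnP _ x0 [in S] (fun x => rho (f x)) x0S) => x1 x1S maxx1.
pose A := [set x in S | f x == f x1].
have sA : subcomplex D A S.
  split=> [|x y]; first by apply/subsetP => x /setIdP[].
  rewrite !inE => /andP[xS /eqP fx] yS Dxy; rewrite yS /=.
  case: (fS _ _ xS yS Dxy) => [<-|]; first by rewrite fx.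
  by rewrite fx ltnNge; have /= -> := maxx1 _ yS.
apply: (exact_split homog sA cS) (eS _) _.
apply: IH (complex_quo sA cS) _ _.
- rewrite -ltnS; apply: leq_trans Sn; rewrite ltnS (cardsD1 x1 S) x1S add1n.
  rewrite ltnS.
  apply/subset_leq_card/subsetP => x /setDP[xS xA]; rewrite !inE xS andbT.
  by apply: contraNneq xA => ->; rewrite inE x1S /=.
- by move=> x y /setDP[xS _] /setDP[yS _]; apply: fS.
move=> g; have [->|gx1] := eqVneq g (f x1).
  suff -> : [set x in S :\: A | f x == f x1] = set0.
    by move=> v _; exists v => y; rewrite inE.
  by apply/setP => x; rewrite !inE; case: (x \in S); case: (f x == _).
suff -> : [set x in S :\: A | f x == g] = [set x in S | f x == g] by apply: eS.
apply/setP => x; rewrite !inE; case: (f x =P g) => [->|_]; last by rewrite !andbF.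
by rewrite (negbTE gx1) andbF !andbT.
Qed.

Lemma exact_pair x y k : D x y != 0 -> exact_at [set x; y] k.
Proof.
move=> Dxy v vS; have dy := homog Dxy.
have yS : y \in [set x; y] by rewrite !inE eqxx orbT.
have neq : x != y by apply/eqP => e; have := n_Sn (deg x); rewrite -dy e.
have sumE u : coapp D [set x; y] u y = u x * D x y.
  rewrite /coapp big_setU1 ?inE // big_set1 /=.
  suff -> : D y y = 0 by rewrite mulr0 addr0.
  by apply/eqP; apply/negPn; apply/negP => /homog /n_Sn.
have [yk|/eqP yk] := eqVneq (deg y) k.
  exists (fun=> v y / D x y) => t; rewrite !inE => /orP[/eqP->|/eqP->] tk.
    by case: (n_Sn (deg x)); rewrite -dy yk tk.
  by rewrite sumE divfK.
exists (fun=> 0) => t; rewrite !inE => /orP[/eqP->|/eqP->] tk; last by case: yk.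
rewrite [RHS]big1 => [|i _]; last by rewrite mul0r.
have := vS y yS; rewrite dy tk sumE => /(_ erefl)/eqP.
by rewrite mulf_eq0 (negbTE Dxy) orbF => /eqP.
Qed.

Lemma coh_dim_fibres (I : finType) (f : T -> I) S k : is_complex S ->
  (forall x y, x \in S -> y \in S -> D x y != 0 -> f x = f y) ->
  coh_dim S k = (\sum_i coh_dim [set x in S | f x == i] k)%N.
Proof.
move=> cS fS; pose Si i := [set x in S | f x == i].
have memi i y : y \in S -> (y \in Si i) = (f y == i) by rewrite inE => ->.
have coappE u y : y \in S -> coapp D S u y = coapp D (Si (f y)) u y.
  move=> yS; rewrite /coapp (big_setID (Si (f y))) /=.
  rewrite (setIidPr _); last by apply/subsetP => x /setIdP[].
  rewrite [X in _ + X]big1 ?addr0 // => x /setDP[xS]; rewrite memi // => fx.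
  apply/eqP; rewrite mulf_eq0; apply/orP; right.
  by apply: contraNT fx => Dxy; rewrite (fS x y).
have ci i : is_complex (Si i).
  move=> x z; rewrite inE => /andP[xS _] zi; have := zi.
  rewrite inE => /andP[zS /eqP fz]; rewrite -[RHS](cS x z xS zS).
  by rewrite -[RHS]/(coapp D S (D x) z) coappE // fz.
have /fin_all_exists[z hz] : forall i, exists z : 'I_(coh_dim (Si i) k) -> T -> K,
    coh_basis (Si i) k z.
  by move=> i; apply: coh_basis_exists.
pose zz (p : {i : I & 'I_(coh_dim (Si i) k)}) x :=
  if f x == tag p then z (tag p) (tagged p) x else 0.
have sumE (c : {i : I & 'I_(coh_dim (Si i) k)} -> K) x :
  \sum_p c p * zz p x = \sum_(l < coh_dim (Si (f x)) k) c (Tagged _ l) * z (f x) l x.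
  transitivity (\sum_i \sum_(l < coh_dim (Si i) k) c (Tagged _ l) * zz (Tagged _ l) x).
    by rewrite sig_big_dep; apply: eq_bigr => -[].
  rewrite (bigD1 (f x)) //= [X in _ + X]big1 ?addr0.
    by apply: eq_bigr => l _; rewrite /zz eqxx.
  move=> i fx; rewrite big1 // => l _.
  by rewrite /zz /= eq_sym (negbTE fx) mulr0.
have -> : coh_dim S k = #|{: {i : I & 'I_(coh_dim (Si i) k)}}|; last first.
  by rewrite card_tagged sumnE big_map big_enum; apply: eq_bigr => i _; rewrite card_ord.
apply: (coh_basis_card cS (z := zz)); split.
- move=> [i l] y yS yk; rewrite coappE // /zz /=.
  have [fy|fy] := eqVneq (f y) i.
    have [zc _ _] := hz i; rewrite -[RHS](zc l y) ?memi ?fy //.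
    by apply: eq_bigr => x /setIdP[_ ->].
  by apply: big1 => x /setIdP[_ /eqP->]; rewrite (negbTE fy) mul0r.
- move=> c [w cw] [i l]; have [_ zi _] := hz i.
  refine (zi (fun l => c (@Tagged _ i (fun i => 'I_(coh_dim (Si i) k)) l)) _ l).
  exists w => y; rewrite inE => /andP[yS /eqP fy] yk.
  by have := cw y yS yk; rewrite sumE coappE // fy.
move=> v vS.
have /fin_all_exists[c hc] : forall i, exists c : 'I_(coh_dim (Si i) k) -> K,
    cobound (Si i) k (fun x => v x - \sum_l c l * z i l x).
  move=> i; have [_ _ zs] := hz i; apply: zs => y yi yk.
  have := yi; rewrite inE => /andP[yS /eqP fy].
  by rewrite -fy -coappE // vS.
have /fin_all_exists[w hw] : forall i, exists w, forall y, y \in Si i ->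
    deg y = k -> v y - \sum_l c i l * z i l y = coapp D (Si i) w y.
  by move=> i; apply: hc.
exists (fun p => c (tag p) (tagged p)), (fun x => w (f x) x) => y yS yk.
rewrite sumE /= coappE // hw ?memi //; apply: eq_bigr => x.
by case/setIdP => _ /eqP->.
Qed.

End Homology.
(** * Transport along bijections of bases *)
Section Transport.
Variables (K : fieldType) (T T' : finType).
Variables (D : T -> T -> K) (deg : T -> nat) (D' : T' -> T' -> K) (deg' : T' -> nat).

Lemma coh_dim_level0 (S : {set T}) k :
  (forall x, x \in S -> deg x != k) -> coh_dim D deg S k = 0%N.
Proof.
move=> Sk; rewrite /coh_dim homology_dimE.
have e : #|level deg S k| = 0%N; last first.
  apply/eqP; rewrite -leqn0 -e.
  exact: leq_trans (leq_subr _ _) (leq_subr _ _).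
apply/eqP; rewrite cards_eq0; apply/eqP/setP => x; rewrite !inE.
by apply/andP => -[/Sk /negbTE->].
Qed.

Variables (S : {set T}) (S' : {set T'}) (f : T -> T') (g : T' -> T) (m : nat).

(** The degrees below m are vacuous: no basis element has such a degree. *)
Lemma exact_at_embed (c : K) k :
  c != 0 -> cancel f g -> S' = f @: S ->
  (forall x y, x \in S -> y \in S -> D' (f x) (f y) = c * D x y) ->
  (forall x, x \in S -> deg' (f x) = (deg x + m)%N) ->
  (forall j, k = (j + m)%N -> exact_at D deg S j) -> exact_at D' deg' S' k.
Proof.
move=> c0 fK eS eD edeg eS'; have fI := can_inj fK.
have coappE u y : y \in S -> coapp D' S' u (f y) = c * coapp D S (u \o f) y.
  move=> yS; rewrite /coapp eS big_imset /=; last by move=> ? ? _ _ /fI.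
  by rewrite mulr_sumr; apply: eq_bigr => x xS; rewrite eD // mulrCA.
have S'P y : y \in S' -> exists2 x, x \in S & y = f x.
  by rewrite eS => /imsetP.
have [km|km] := ltnP k m.
  move=> v _; exists v => _ /S'P[x xS ->]; rewrite edeg // => e.
  by move: km; rewrite -e ltnNge leq_addl.
have kE : k = (k - m + m)%N by rewrite subnK.
move=> v vS; have [|w vw] := eS' _ kE (v \o f).
  move=> y yS yk; apply: (mulfI c0); rewrite mulr0 -coappE // vS //.
    by rewrite eS imset_f.
  by rewrite edeg // yk addSn subnK.
exists (fun y => c^-1 * w (g y)) => _ /S'P[x xS ->]; rewrite edeg // => e.
rewrite coappE // -[v (f x)]/((v \o f) x) vw //; last by rewrite -e addnK.
rewrite /coapp mulr_sumr; apply: eq_bigr => y yS /=.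
by rewrite fK !mulrA divff // mul1r.
Qed.

(** The differentials agree after rescaling the basis; in the applications the
    scalars are signs caused by a different order of the vertices. *)
Lemma coh_dim_iso (sg tg : T -> K) k :
  (forall x, x \in S -> f x \in S' /\ g (f x) = x) ->
  (forall y, y \in S' -> g y \in S /\ f (g y) = y) ->
  (forall x, x \in S -> sg x != 0) -> (forall x, x \in S -> tg x != 0) ->
  (forall x y, x \in S -> y \in S ->
     D x y = sg x * tg y * D' (f x) (f y)) ->
  (forall x, x \in S -> deg' (f x) = (deg x + m)%N) ->
  coh_dim D' deg' S' (k + m) = coh_dim D deg S k.
Proof.
move=> fS gS s0 t0 eD edeg.
have edeg' y : y \in S' -> deg' y = (deg (g y) + m)%N.
  by move=> /gS[gyS gyK]; rewrite -{1}gyK edeg.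
have lf j x : x \in level deg S j -> f x \in level deg' S' (j + m).
  by rewrite !inE => /andP[xS /eqP <-]; rewrite (fS _ xS).1 edeg ?eqxx.
have lg j x : x \in level deg' S' (j + m) -> g x \in level deg S j.
  rewrite !inE => /andP[xS]; rewrite edeg' // eqn_add2r => ->.
  by rewrite (gS _ xS).1.
have bf j x : x \in below deg S j -> f x \in below deg' S' (j + m).
  by rewrite !inE => /andP[xS /eqP <-]; rewrite (fS _ xS).1 edeg ?eqxx.
have bg j x : x \in below deg' S' (j + m) -> g x \in below deg S j.
  rewrite !inE => /andP[xS]; rewrite edeg' // -addSn eqn_add2r => ->.
  by rewrite (gS _ xS).1.
have eD' x y : x \in S' -> y \in S' ->
    D' x y = (sg (g x))^-1 * (tg (g y))^-1 * D (g x) (g y).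
  move=> xS yS; have [gxS gxK] := gS _ xS; have [gyS gyK] := gS _ yS.
  by rewrite eD // gxK gyK -invfM mulrA mulVf ?mul1r // mulf_neq0 ?s0 ?t0.
have inS j x : x \in level deg S j -> x \in S by case/setIdP.
have inS' j x : x \in level deg' S' j -> x \in S' by case/setIdP.
have inb j x : x \in below deg S j -> x \in S by case/setIdP.
have inb' j x : x \in below deg' S' j -> x \in S' by case/setIdP.
have el : #|level deg' S' (k + m)| = #|level deg S k|.
  rewrite -[RHS](card_in_imset (f := f)).
    suff -> : f @: level deg S k = level deg' S' (k + m) by [].
    apply/setP => y; apply/imsetP/idP => [[x /lf ? ->]|yl] //.
    by exists (g y); rewrite ?lg // (gS _ (inS' _ _ yl)).2.
  move=> x y /inS xS /inS yS /(congr1 g).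
  by rewrite (fS _ xS).2 (fS _ yS).2.
rewrite /coh_dim !homology_dimE; congr (_ - _ - _)%N => //; apply/eqP.
  rewrite eqn_leq; apply/andP; split.
    apply: (rank_incmx_le (f := g) (g := g) (sf := fun x => (sg (g x))^-1)
              (sg := fun x => (tg (g x))^-1)) (lg _) (lg k.+1) _.
    by move=> x y /inS' xS /inS' yS; apply: eD'.
  apply: (rank_incmx_le (f := f) (g := f) (sf := sg) (sg := tg)) (lf _) (lf k.+1) _.
  by move=> x y /inS xS /inS yS; apply: eD.
rewrite eqn_leq; apply/andP; split.
  apply: (rank_incmx_le (f := g) (g := g) (sf := fun x => (sg (g x))^-1)
            (sg := fun x => (tg (g x))^-1)) (bg _) (lg _) _.
  by move=> x y /inb' xS /inS' yS; apply: eD'.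
apply: (rank_incmx_le (f := f) (g := f) (sf := sg) (sg := tg)) (bf _) (lf _) _.
by move=> x y /inb xS /inS yS; apply: eD.
Qed.

End Transport.

(** * Families of sets with the simplicial differential *)
Section SetFamilies.
Variables (K : fieldType) (V : finType).
Implicit Types (v w : V) (s t u : {set V}) (S : {set {set V}}).

(** The entries of the coboundary matrices of a simplicial complex, as a
    function of two arbitrary sets. *)
Definition incidence s t : K :=
  \sum_(v in t | t :\ v == s)
    (-1) ^+ #|[set w in t | (enum_rank w < enum_rank v)%N]|.

Local Notation eps := incidence.
Local Notation card := (fun s : {set V} => #|s|).

Definition ltsgn v w : K := (-1) ^+ (enum_rank v < enum_rank w)%N.

(** The sign (-1)^m for the number m of elements of s before v; as a product it
    is multiplicative in s. *)
Definition possgn v s : K := \prod_(w in s) ltsgn w v.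

Lemma ltsgn_neq0 v w : ltsgn v w != 0.
Proof. by rewrite /ltsgn; case: ltnP; rewrite ?oppr_eq0 oner_neq0. Qed.

Lemma possgn_neq0 v s : possgn v s != 0.
Proof. by apply/prodf_neq0 => w _; apply: ltsgn_neq0. Qed.

Lemma ltsgn_sq v w : ltsgn v w * ltsgn v w = 1.
Proof. by rewrite /ltsgn -expr2 sqrr_sign. Qed.

Lemma ltsgnC v w : v != w -> ltsgn w v = - ltsgn v w.
Proof.
move=> vw; rewrite /ltsgn; case: ltngtP => [_|_|e]; rewrite ?opprK //.
by case/eqP: vw; apply/enum_rank_inj/val_inj.
Qed.

Lemma possgnU1 v w s : w \notin s -> possgn v (w |: s) = ltsgn w v * possgn v s.
Proof. exact: big_setU1. Qed.

Lemma incidenceU1 v s : v \notin s -> eps s (v |: s) = possgn v s.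
Proof.
move=> vs; rewrite /incidence (big_pred1 v) => [|w]; last first.
  apply/andP/eqP => [[_ /eqP e]|->]; last by rewrite setU11 setU1K.
  apply/eqP; apply: contraNT vs => wv.
  by rewrite -e !inE eqxx andbT eq_sym.
have -> : [set w in v |: s | (enum_rank w < enum_rank v)%N] =
    [set w in s | (enum_rank w < enum_rank v)%N].
  by apply/setP => w; rewrite !inE; case: eqP => [->|]; rewrite // ltnn !andbF.
rewrite -prodr_const; under eq_bigl do rewrite inE.
rewrite big_mkcondr; apply: eq_bigr => w _.
by rewrite /ltsgn; case: ltnP.
Qed.

Lemma incidence_neq0 s t : eps s t != 0 -> exists2 v, v \notin s & t = v |: s.
Proof.
move=> e; have [v /andP[vt /eqP ts]|no] := pickP [pred v in t | t :\ v == s].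
  by exists v; rewrite -ts ?setD1K // !inE eqxx.
case/eqP: e; rewrite /incidence big_pred0 // => v; exact: no.
Qed.

Lemma incidence_card s t : eps s t != 0 -> #|t| = #|s|.+1.
Proof. by case/incidence_neq0 => v vs ->; rewrite cardsU1 vs. Qed.

Lemma incidence_sub s t : eps s t != 0 -> s \subset t.
Proof. by case/incidence_neq0 => v _ ->; apply: subsetUr. Qed.

(** If u = s + v + w, the two sets between s and u contribute opposite signs,
    as exactly one of v and w precedes the other one. *)
Lemma incidence_sq s u : \sum_t eps s t * eps t u = 0.
Proof.
have [t0 /andP[e1 e2]|no] := pickP [pred t | (eps s t != 0) && (eps t u != 0)];
  last first.
  apply: big1 => t _; apply/eqP; have /= := no t.
  by rewrite mulf_eq0 => /negbT; rewrite negb_and !negbK.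
have [v vs tE] := incidence_neq0 e1; have [w wt uE] := incidence_neq0 e2.
move: wt; rewrite tE !inE negb_or => /andP[wv ws].
have vws : v \notin w |: s by rewrite !inE negb_or eq_sym wv.
have wvs : w \notin v |: s by rewrite !inE negb_or wv.
have uE' : u = v |: (w |: s) by rewrite uE tE setUCA.
rewrite (bigD1 (v |: s)) //= (bigD1 (w |: s)) /=; last first.
  apply/eqP => /setP/(_ w); rewrite !inE eqxx (negbTE ws) (negbTE wv).
  by [].
rewrite big1 ?addr0 => [|t /andP[tv tw]].
  rewrite {1}uE tE uE' !incidenceU1 // !possgnU1 // (ltsgnC wv).
  by ring.
have [->|f1] := eqVneq (eps s t) 0; first by rewrite mul0r.
apply/eqP; rewrite mulf_eq0 (negbTE f1) /=.
apply: contraNT tw => f2; have [a as_ tE'] := incidence_neq0 f1.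
have : a \in u by rewrite (subsetP (incidence_sub f2)) // tE' setU11.
rewrite uE tE !inE (negbTE as_) orbF => /orP[/eqP e|/eqP e].
  by rewrite tE' e.
by case/eqP: tv; rewrite tE' e.
Qed.

(** The families that span subquotients of the cochain complex of the full
    simplex. *)
Definition convex S :=
  forall s t u, s \in S -> u \in S -> s \subset t -> t \subset u -> t \in S.

Lemma convex_complex S : convex S -> is_complex eps S.
Proof.
move=> cS s u sS uS; rewrite -[RHS](incidence_sq s u) [RHS](bigID [in S]) /=.
rewrite [X in _ + X]big1 ?addr0 // => t tS; apply/eqP; rewrite mulf_eq0.
rewrite -[_ || _]negbK negb_or; apply: contra tS => /andP[st tu].
exact: cS sS uS (incidence_sub st) (incidence_sub tu).
Qed.

(** Group the sets first by s :&: C, which determines the vertex p, and then by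
    s minus p.  This is a filtration of the complex, and each group is a pair
    s, s + p joined by a differential equal to a sign. *)
Lemma toggle_exact S (C : {set V}) (p : {set V} -> V) k : convex S ->
  (forall s, s \in S -> p (s :&: C) \notin C) ->
  (forall s, s \in S -> p (s :&: C) |: s \in S) ->
  (forall s, s \in S -> s :\ p (s :&: C) \in S) ->
  exact_at eps card S k.
Proof.
move=> cS pC pU pD.
pose f s := s :\ p (s :&: C); pose rho s := (#|s :&: C| * #|V|.+1 + #|s|)%N.
have fC s : s \in S -> f s :&: C = s :&: C.
  move=> sS; apply/setP => x; rewrite !inE; case: eqP => //= ->.
  by rewrite (negbTE (pC s sS)) andbF.
apply: (exact_fibres incidence_card (f := f) (rho := rho)) (convex_complex cS) _ _.
  move=> s t sS tS /incidence_neq0[v vs tE]; rewrite /rho !fC //.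
  have [vC|vC] := boolP (v \in C).
    right; have -> : t :&: C = v |: (s :&: C).
      by rewrite tE setIUl (setIidPl _) // sub1set.
    rewrite cardsU1 !inE (negbTE vs) /= add1n mulSn -addnA addnCA.
    by rewrite ltn_add2l ltn_addr // ltnS max_card.
  have tC : t :&: C = s :&: C.
    rewrite tE setIUl (_ : [set v] :&: C = set0) ?set0U //.
    by apply/setP => x; rewrite !inE; case: eqP => // ->; rewrite (negbTE vC).
  rewrite tC /f tC; have [<-|vp] := eqVneq v (p (s :&: C)).
    left; rewrite tE setU1K //; apply/setP => x; rewrite !inE.
    by case: eqP => // ->; rewrite (negbTE vs).
  right; rewrite ltn_add2l; apply: proper_card; rewrite tE.
  apply/properP; split; first by apply/setSD/subsetUr.
  by exists v; rewrite !inE ?eqxx ?vp //= negb_and vs orbT.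
move=> t; have [/existsP[s /andP[sS /eqP st]]|no] :=
    boolP [exists s, (s \in S) && (f s == t)]; last first.
  suff -> : [set s in S | f s == t] = set0 by move=> u _; exists u => y; rewrite inE.
  apply/setP => s; rewrite !inE; apply: contraNF no => sS.
  by apply/existsP; exists s.
have tC : t :&: C = s :&: C by rewrite -st fC.
pose v := p (t :&: C).
have vt : v \notin t by rewrite -st /v tC !inE eqxx.
suff -> : [set s in S | f s == t] = [set t; v |: t].
  by apply: (exact_pair incidence_card); rewrite incidenceU1 // possgn_neq0.
have tS : t \in S by rewrite -st pD.
have vC : v \notin C by apply: pC.
apply/setP => r; rewrite !inE; apply/andP/orP => [[rS /eqP rt]|[]/eqP->].
- have : v \in r \/ v \notin r by case: (v \in r); [left|right].
  have pr : p (r :&: C) = v by rewrite /v -rt fC.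
  case=> vr; [right|left]; apply/eqP.
    by rewrite -rt /f pr setD1K.
  rewrite -rt /f pr; apply/setP => x; rewrite !inE.
  by case: eqP => // ->; rewrite (negbTE vr).
- split=> //; apply/eqP/setP => x; rewrite !inE -/v.
  by case: eqP => // ->; rewrite (negbTE vt).
split; first exact: pU.
have tvC : (v |: t) :&: C = t :&: C.
  rewrite setIUl (_ : [set v] :&: C = set0) ?set0U //.
  by apply/setP => x; rewrite !inE; case: eqP => // ->; rewrite (negbTE vC).
by rewrite /f tvC setU1K.
Qed.

Definition coh_poly S : {poly rat} := \poly_(k < #|V|.+1) (coh_dim eps card S k)%:R.

Lemma coef_coh_poly S k : (coh_poly S)`_k = (coh_dim eps card S k)%:R.
Proof.
rewrite coef_poly ltnS; case: leqP => // Vk; rewrite coh_dim_level0 // => s _.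
by rewrite neq_ltn (leq_ltn_trans (max_card _) Vk).
Qed.

Lemma coh_poly_toggle S (C : {set V}) (p : {set V} -> V) : convex S ->
  (forall s, s \in S -> p (s :&: C) \notin C) ->
  (forall s, s \in S -> p (s :&: C) |: s \in S) ->
  (forall s, s \in S -> s :\ p (s :&: C) \in S) -> coh_poly S = 0.
Proof.
move=> cS pC pU pD; apply/polyP => k; rewrite coef_coh_poly coef0 coh_dim_exact //.
- exact: incidence_card.
- exact: convex_complex.
exact: toggle_exact pC pU pD.
Qed.

End SetFamilies.
(** * Double complexes *)
Section TotalComplex.
Variables (K : fieldType) (V J : finType) (DJ : J -> J -> K) (lv : J -> nat).
Hypothesis homogJ : forall j l, DJ j l != 0 -> lv l = (lv j).+1.

Local Notation eps := (@incidence K V).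
Local Notation card := (fun s : {set V} => #|s|).
Implicit Types (x y z : {set V} * J) (s t u : {set V}) (j l : J).

(** The double complex with the simplicial differential in the first coordinate
    and DJ in the second one, with the Koszul sign. *)
Definition totdiff x y : K :=
  (x.2 == y.2)%:R * eps x.1 y.1 + (-1) ^+ #|x.1| * (x.1 == y.1)%:R * DJ x.2 y.2.

Definition totdeg x := (#|x.1| + lv x.2)%N.

Lemma incidence_ss s : eps s s = 0.
Proof.
by apply/eqP; apply/negPn; apply/negP => /incidence_card /n_Sn.
Qed.

Lemma DJ_jj j : DJ j j = 0.
Proof. by apply/eqP; apply/negPn; apply/negP => /homogJ /n_Sn. Qed.

Lemma totdiff_fst s j l : totdiff (s, j) (s, l) = (-1) ^+ #|s| * DJ j l.
Proof. by rewrite /totdiff /= incidence_ss mulr0 add0r eqxx mulr1. Qed.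

Lemma totdiff_snd s t j : totdiff (s, j) (t, j) = eps s t.
Proof. by rewrite /totdiff /= DJ_jj mulr0 addr0 eqxx mul1r. Qed.

Lemma totdiff_neq0 x y : totdiff x y != 0 ->
  (x.2 = y.2 /\ eps x.1 y.1 != 0) \/ (x.1 = y.1 /\ DJ x.2 y.2 != 0).
Proof.
case: x y => [s j] [t l] /=; have [<-|jl] := eqVneq j l.
  by rewrite totdiff_snd; left.
have [<-|st] := eqVneq s t.
  by rewrite totdiff_fst mulf_eq0 negb_or => /andP[_]; right.
by rewrite /totdiff /= (negbTE jl) (negbTE st) mulr0 !mul0r addr0 eqxx.
Qed.

Lemma totdiff_homog x y : totdiff x y != 0 -> totdeg y = (totdeg x).+1.
Proof.
rewrite /totdeg; case/totdiff_neq0 => -[<-].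
  by move=> /incidence_card ->; rewrite addSn.
by move=> /homogJ ->; rewrite addnS.
Qed.

Lemma sum_embed (I T : finType) (A : {set I}) (S : {set T}) (h : I -> T)
    (F : T -> K) : injective h -> (forall i, (h i \in S) = (i \in A)) ->
  (forall y : T, y \in S -> y \notin h @: A -> F y = 0) ->
  \sum_(y in S) F y = \sum_(i in A) F (h i).
Proof.
move=> hI hA F0; rewrite (big_setID (h @: A)) /= (setIidPr _); last first.
  by apply/subsetP => _ /imsetP[i iA ->]; rewrite hA.
rewrite big_imset /=; last by move=> ? ? _ _ /hI.
rewrite [X in _ + X]big1 ?addr0 // => y /setDP[yS yh]; exact: F0.
Qed.

Variable S : {set {set V} * J}.

Definition column s := [set j | (s, j) \in S].
Definition row_family j := [set s | (s, j) \in S].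

Lemma totdiff_fibre_exact s k :
  (forall i, k = (i + #|s|)%N -> exact_at DJ lv (column s) i) ->
  exact_at totdiff totdeg [set x in S | x.1 == s] k.
Proof.
move=> eS; apply: (exact_at_embed (f := fun j => (s, j)) (g := snd)
  (c := (-1) ^+ #|s|)) eS => //.
- by rewrite signr_eq0.
- apply/setP => -[t j]; rewrite inE /=; apply/andP/imsetP.
    by move=> [tS /eqP ts]; exists j; rewrite ?inE -?ts.
  by move=> [l]; rewrite inE => sl [-> ->].
- by move=> j l _ _; rewrite totdiff_fst.
by move=> j _; rewrite /totdeg /= addnC.
Qed.

Lemma totdiff_row_exact j k :
  (forall i, exact_at eps card (row_family j) i) ->
  exact_at totdiff totdeg [set x in S | x.2 == j] k.
Proof.
move=> eS; apply: (exact_at_embed (f := fun s => (s, j)) (g := fst) (c := 1)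
  (m := lv j)) => //.
- exact: oner_neq0.
- apply/setP => -[t l]; rewrite inE /=; apply/andP/imsetP.
    by move=> [tS /eqP ts]; exists t; rewrite ?inE -?ts.
  by move=> [s]; rewrite inE => sl [-> ->].
by move=> s t _ _; rewrite totdiff_snd mul1r.
Qed.

(** Filter by the first coordinate. *)
Lemma totdiff_exact k : is_complex totdiff S ->
  (forall s i, (k = i + #|s|)%N -> exact_at DJ lv (column s) i) ->
  exact_at totdiff totdeg S k.
Proof.
move=> cS eS; apply: (exact_fibres totdiff_homog (f := fst) (rho := card)).
- exact: cS.
- move=> x y _ _ /totdiff_neq0[[_ /incidence_card e]|[]]; last by left.
  by right; rewrite e.
move=> s; apply: totdiff_fibre_exact; exact: eS.
Qed.

(** Filter by the level of the second coordinate. *)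
Lemma totdiff_exact_rows k : is_complex totdiff S ->
  (forall j i, exact_at eps card (row_family j) i) ->
  exact_at totdiff totdeg S k.
Proof.
move=> cS eS; apply: (exact_fibres totdiff_homog (f := snd) (rho := lv)).
- exact: cS.
- move=> x y _ _ /totdiff_neq0[[->]|[_ /homogJ e]]; first by left.
  by right; rewrite e.
move=> s; apply: totdiff_row_exact; exact: eS.
Qed.

Hypothesis convS : forall j, convex (row_family j).
Hypothesis colS : forall s, is_complex DJ (column s).
(* a square with two opposite corners in S has all corners in S, so that the
   paths along its sides cancel *)
Hypothesis cornerS : forall s t j l, s \subset t -> (s, j) \in S ->
  (t, l) \in S -> DJ j l != 0 -> (s, l) \in S /\ (t, j) \in S.

Lemma totdiff_complex : is_complex totdiff S.
Proof.
case=> [s j] [u m] sS uS.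
have fstE (F : {set V} * J -> K) t : \sum_(y in S) (t == y.1)%:R * F y =
    \sum_(l in column t) F (t, l).
  rewrite (sum_embed (A := column t) (h := fun l => (t, l))) /=.
  - by apply: eq_bigr => l _; rewrite eqxx mul1r.
  - by move=> l l' [].
  - by move=> l; rewrite inE.
  case=> r l; have [<-|rt] := eqVneq t r; last by rewrite mul0r.
  by move=> rS /negP[]; apply/imsetP; exists l; rewrite ?inE.
have sndE (F : {set V} * J -> K) l : \sum_(y in S) (l == y.2)%:R * F y =
    \sum_(t in row_family l) F (t, l).
  rewrite (sum_embed (A := row_family l) (h := fun t => (t, l))) /=.
  - by apply: eq_bigr => t _; rewrite eqxx mul1r.
  - by move=> t t' [].
  - by move=> t; rewrite inE.
  case=> t l'; have [<-|lt] := eqVneq l l'; last by rewrite mul0r.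
  by move=> tS /negP[]; apply/imsetP; exists t; rewrite ?inE.
have delta (X : finType) (A : {set X}) (F : X -> K) a :
    \sum_(b in A) F b * (b == a)%:R = (a \in A)%:R * F a.
  rewrite big_mkcond (bigD1 a) //= eqxx big1 ?addr0 => [|b ba].
    by case: ifP => _; rewrite ?mul0r // mulr1 mul1r.
  by case: ifP; rewrite // (negbTE ba) mulr0.
rewrite (eq_bigr (fun y =>
  (j == y.2)%:R * (eps s y.1 * totdiff y (u, m)) +
  (s == y.1)%:R * ((-1) ^+ #|s| * DJ j y.2 * totdiff y (u, m)))); last first.
  case=> t l _; set X := totdiff _ (u, m); rewrite /totdiff /=.
  ring.
rewrite big_split /= fstE sndE /totdiff /=.
rewrite (eq_bigr (fun t => (j == m)%:R * (eps s t * eps t u) +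
  eps s t * (-1) ^+ #|t| * DJ j m * (t == u)%:R)); last by move=> t _; ring.
rewrite big_split /= delta -mulr_sumr.
rewrite [X in _ + _ + X](eq_bigr (fun l =>
  (-1) ^+ #|s| * DJ j l * eps s u * (l == m)%:R +
  (s == u)%:R * (DJ j l * DJ l m * (-1) ^+ (#|s| + #|s|)))); last first.
  by move=> l _; rewrite exprD; ring.
rewrite big_split /= delta -mulr_sumr.
have -> : (j == m)%:R * (\sum_(t in row_family j) eps s t * eps t u) = 0.
  have [jm|_] := eqVneq j m; last by rewrite mul0r.
  by rewrite (convex_complex K (@convS j)) ?mulr0 // inE // jm.
have -> : (s == u)%:R *
    (\sum_(l in column s) DJ j l * DJ l m * (-1) ^+ (#|s| + #|s|)) = 0.
  have [su|_] := eqVneq s u; last by rewrite mul0r.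
  by rewrite -mulr_suml colS ?mul0r ?mulr0 // inE // su.
rewrite add0r addr0 !inE.
have [->|e] := eqVneq (eps s u) 0; first by rewrite !(mulr0, mul0r) addr0.
have [->|d] := eqVneq (DJ j m) 0; first by rewrite !(mulr0, mul0r) addr0.
have [-> ->] := cornerS (incidence_sub e) sS uS d.
by rewrite (incidence_card e) exprS; ring.
Qed.

End TotalComplex.
(** * The Kunneth formula for families of sets *)
Section Cone.
Variables (K : fieldType) (V : finType) (B : {set {set V}}).
Local Notation eps := (@incidence K V).
Local Notation card := (fun s : {set V} => #|s|).
Local Notation hB := (coh_dim eps card B).
Local Notation N := #|V|.+1.
Hypothesis convB : convex B.
Variable z : forall i : 'I_N, 'I_(hB i) -> {set V} -> K.
Hypothesis hz : forall i : 'I_N, coh_basis eps card B i (@z i).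

(** The mapping cone of the map from the cohomology of B to B that is given by
    the representatives z.  The degrees on B are raised by one, so that the new
    element that maps to a cocycle of degree i can have degree i. *)
Definition coneT : finType := ({set V} + {i : 'I_N & 'I_(hB i)})%type.

Definition cone_diff (x y : coneT) : K :=
  match x, y with
  | inl b, inl b' => eps b b'
  | inr p, inl b => (#|b| == tag p)%:R * z (tagged p) b
  | _, inr _ => 0
  end.

Definition cone_lv (x : coneT) : nat :=
  match x with inl b => #|b|.+1 | inr p => tag p end.

Definition cone : {set coneT} := [set x | if x is inl b then b \in B else true].

Lemma cone_homog x y : cone_diff x y != 0 -> cone_lv y = (cone_lv x).+1.
Proof.
case: x y => [b|p] [b'|q] //=; rewrite ?eqxx //; first by move/incidence_card ->.
by case: (#|b'| =P tag p) => [->|]; rewrite //= mul0r eqxx.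
Qed.

Lemma coapp_cone (v : coneT -> K) b :
  coapp cone_diff cone v (inl b) = coapp eps B (v \o inl) b +
    \sum_p v (inr p) * cone_diff (inr p) (inl b).
Proof.
rewrite /coapp big_sumType /=; congr (_ + _); apply: eq_bigl => x; by rewrite inE.
Qed.

Lemma coapp_cone_inr (v : coneT -> K) p : coapp cone_diff cone v (inr p) = 0.
Proof. by apply: big1 => -[b|q] _ /=; rewrite mulr0. Qed.

Lemma cone_complex : is_complex cone_diff cone.
Proof.
move=> x [b|q] xc yc; last exact: coapp_cone_inr (cone_diff x) q.
rewrite -[LHS]/(coapp cone_diff cone (cone_diff x) (inl b)) coapp_cone.
rewrite !inE in xc yc; rewrite [X in _ + X]big1 ?addr0 => [|p _]; last first.
  by case: x xc => [?|?] _; rewrite /= mul0r.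
case: x xc => [a|p] xc; first exact: (convex_complex K convB xc yc).
have [zc _ _] := hz (tag p).
have [bp|bp] := eqVneq #|b| (tag p).+1.
  rewrite -[RHS](zc (tagged p) b) //; apply: (coapp_ext (@incidence_card K V)).
  by move=> a aB; rewrite bp => -[e] /=; rewrite e eqxx mul1r.
apply: (coapp_eq0 (@incidence_card K V)) => a aB ab /=.
by case: (#|a| =P tag p) => [e|_]; rewrite ?mul0r //; case/eqP: bp; rewrite -ab e.
Qed.

Lemma cone_term (u : coneT -> K) (b : {set V}) (i : 'I_N) : #|b| = i ->
  \sum_p u (inr p) * cone_diff (inr p) (inl b) =
  \sum_(l < hB i) u (inr (@Tagged _ i (fun i : 'I_N => 'I_(hB i)) l)) * z l b.
Proof.
move=> bi.
transitivity (\sum_(j < N) \sum_(l < hB j)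
    u (inr (@Tagged _ j (fun j : 'I_N => 'I_(hB j)) l)) *
    cone_diff (inr (@Tagged _ j (fun j : 'I_N => 'I_(hB j)) l)) (inl b)).
  by rewrite sig_big_dep; apply: eq_bigr => -[].
rewrite (bigD1 i) //= [X in _ + X]big1 ?addr0.
  by apply: eq_bigr => l _; rewrite bi eqxx mul1r.
move=> j ji; apply: big1 => l _; rewrite bi (_ : (i == j :> nat) = false).
  by rewrite mul0r mulr0.
by apply/negbTE; rewrite eq_sym.
Qed.

(** Injectivity and surjectivity of the map onto the cohomology of B, hence
    independence and spanning of the representatives. *)
Lemma cone_exact k : exact_at cone_diff cone_lv cone k.
Proof.
move=> v vS.
have v0 (p : {i : 'I_N & 'I_(hB i)}) : tag p = k :> nat -> v (inr p) = 0.
  case: p => [i l] /= ik; have [_ zi _] := hz i.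
  refine (zi (fun l => v (inr (@Tagged _ i (fun i : 'I_N => 'I_(hB i)) l))) _ l).
  exists (fun b => - v (inl b)) => b bB bi; rewrite coappN.
  have lvb : cone_lv (inl b) = k.+1 by rewrite /= bi ik.
  have := vS (inl b) _ lvb; rewrite inE => /(_ bB).
  by rewrite coapp_cone (cone_term _ bi) addrC => /eqP; rewrite addr_eq0 => /eqP.
have [k0|k_gt0] := posnP k.
  exists (fun=> 0) => -[b|p] _ /= e; first by rewrite k0 in e.
  by rewrite coapp_cone_inr v0.
have [kN|kN] := ltnP N k.
  exists (fun=> 0) => -[b|p] _ /= e; last by rewrite coapp_cone_inr v0.
  by move: kN; rewrite -e ltnS ltnNge max_card.
pose i : 'I_N := inord k.-1.
have ik : k = i.+1 by rewrite inordK prednK.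
have [_ _ zs] := hz i; have [|c [w cw]] := zs (v \o inl).
  move=> b bB bi; have := vS (inl b); rewrite inE /= bi -ik => /(_ bB erefl).
  rewrite coapp_cone [X in _ + X]big1 ?addr0 // => p _ /=.
  by case: (#|b| =P tag p) => [e|_]; rewrite ?mul0r ?mulr0 // v0 ?mul0r // -e bi -ik.
pose W (x : coneT) := match x with
  | inl b => w b
  | inr p => if tag p =P i is ReflectT e
             then c (cast_ord (congr1 (fun j : 'I_N => hB j) e) (tagged p)) else 0
  end.
exists W => -[b|p] xS /= e; last by rewrite coapp_cone_inr v0.
rewrite inE in xS; have bi : #|b| = i by move: e; rewrite ik => -[].
rewrite coapp_cone (cone_term _ bi) -[coapp _ _ _ _]/(coapp eps B w b) -cw //=.
apply/eqP; rewrite -addrA -subr_eq0 opprD addNKr oppr_eq0.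
rewrite addrC subr_eq0; apply/eqP/eq_bigr => l _ /=.
case: eqP => // e'; congr (c _ * _); exact/val_inj.
Qed.

End Cone.

Section Kunneth.
Variables (K : fieldType) (V : finType) (C : {set V}) (A B : {set {set V}}).
Local Notation eps := (@incidence K V).
Local Notation card := (fun s : {set V} => #|s|).
Local Notation N := #|V|.+1.
Hypothesis convA : convex A.
Hypothesis convB : convex B.
Hypothesis subA : forall a, a \in A -> a \subset C.
Hypothesis subB : forall b, b \in B -> b \subset ~: C.

(** The tensor product of the two complexes, for A supported in C and B supported
    outside C. *)
Definition join : {set {set V}} := [set s | (s :&: C \in A) && (s :\: C \in B)].

(** The sign of the permutation that puts the elements of a in front of those of
    b. *)
Definition twist (a b : {set V}) : K := \prod_(v in a) possgn K v b.

Lemma twist_neq0 a b : twist a b != 0.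
Proof. by apply/prodf_neq0 => v _; apply: possgn_neq0. Qed.

Lemma twist_sq a b : twist a b * twist a b = 1.
Proof.
rewrite /twist -big_split /= big1 // => v _.
by rewrite /possgn -big_split /= big1 // => w _; rewrite ltsgn_sq.
Qed.

Lemma possgnU v (s t : {set V}) : [disjoint s & t] ->
  possgn K v (s :|: t) = possgn K v s * possgn K v t.
Proof. by move=> st; rewrite /possgn (eq_bigl [predU s & t]) ?bigU // => w; rewrite inE. Qed.

Lemma incidence_joinl (a : {set V}) v (b : {set V}) : v \notin a -> v \notin b -> [disjoint a & b] ->
  eps (a :|: b) (v |: a :|: b) = twist a b * twist (v |: a) b * eps a (v |: a).
Proof.
move=> va vb ab; rewrite -setUA !incidenceU1 ?inE ?negb_or ?va //.
rewrite possgnU // /twist big_setU1 //=.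
by rewrite -/(twist a b) -[LHS]mul1r -(twist_sq a b); ring.
Qed.

Lemma incidence_joinr (a : {set V}) v (b : {set V}) : v \notin a -> v \notin b -> [disjoint a & b] ->
  eps (a :|: b) (a :|: (v |: b)) =
    twist a b * twist a (v |: b) * ((-1) ^+ #|a| * eps b (v |: b)).
Proof.
move=> va vb ab; rewrite setUCA !incidenceU1 ?inE ?negb_or ?va //.
rewrite possgnU //.
have -> : twist a (v |: b) = \prod_(w in a) ltsgn K v w * twist a b.
  rewrite /twist -big_split /=; apply: eq_bigr => w _.
  by rewrite possgnU1.
have -> : possgn K v a = (-1) ^+ #|a| * \prod_(w in a) ltsgn K v w.
  rewrite -prodr_const -big_split /=; apply: eq_bigr => w wa.
  by rewrite mulN1r -ltsgnC //; apply: contraNneq va => ->.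
by rewrite -[LHS]mul1r -(twist_sq a b); ring.
Qed.

Lemma split_in (a b : {set V}) : a \subset C -> b \subset ~: C ->
  (a :|: b) :&: C = a /\ (a :|: b) :\: C = b.
Proof.
move=> aC bC; split; apply/setP => x; rewrite !inE.
  have [xa|xa] /= := boolP (x \in a); first by rewrite (subsetP aC).
  have [xb|xb] //= := boolP (x \in b).
  by have := subsetP bC _ xb; rewrite inE => /negbTE.
have [xa|xa] /= := boolP (x \in a).
  rewrite (subsetP aC) //=; apply/esym/negbTE/negP => xb.
  by have := subsetP bC _ xb; rewrite inE (subsetP aC).
have [xb|xb] //= := boolP (x \in b); last by rewrite andbF.
by have := subsetP bC _ xb; rewrite inE => ->.
Qed.

Lemma incidence_join (s t : {set V}) :
  eps s t = twist (s :&: C) (s :\: C) * twist (t :&: C) (t :\: C) *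
    ((s :\: C == t :\: C)%:R * eps (s :&: C) (t :&: C) +
     (-1) ^+ #|s :&: C| * (s :&: C == t :&: C)%:R * eps (s :\: C) (t :\: C)).
Proof.
have disj : [disjoint s :&: C & s :\: C].
  rewrite -setI_eq0; apply/eqP/setP => x; rewrite !inE.
  by case: (x \in C); rewrite ?andbF.
have [e0|/incidence_neq0[v vs ->]] := eqVneq (eps s t) 0.
  have d1 : (s :\: C == t :\: C)%:R * eps (s :&: C) (t :&: C) = 0.
    case: (eqVneq (s :\: C) (t :\: C)) => [eD|_]; last by rewrite mul0r.
    have [->|/incidence_neq0[v vs tE]] := eqVneq (eps (s :&: C) (t :&: C)) 0.
      by rewrite mulr0.
    have vC : v \in C by have := setU11 v (s :&: C); rewrite -tE => /setIP[].
    rewrite !inE vC andbT in vs; move/eqP: e0.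
    rewrite -(setID t C) tE -eD -setUA setID incidenceU1 //.
    by rewrite (negbTE (possgn_neq0 _ _ _)).
  have d2 : (s :&: C == t :&: C)%:R * eps (s :\: C) (t :\: C) = 0.
    case: (eqVneq (s :&: C) (t :&: C)) => [eI|_]; last by rewrite mul0r.
    have [->|/incidence_neq0[v vs tE]] := eqVneq (eps (s :\: C) (t :\: C)) 0.
      by rewrite mulr0.
    have vC : v \notin C by have := setU11 v (s :\: C); rewrite -tE => /setDP[].
    rewrite !inE vC /= in vs; move/eqP: e0.
    rewrite -(setID t C) tE -eI setUCA setID incidenceU1 //.
    by rewrite (negbTE (possgn_neq0 _ _ _)).
  by rewrite e0 d1 -[_ * _ * eps (s :\: C) _]mulrA d2 mulr0 addr0 mulr0.
rewrite setIUl setDUl; have [vC|vC] := boolP (v \in C).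
  have vI : v \notin s :&: C by rewrite !inE negb_and vs.
  have -> : [set v] :&: C = [set v] by apply/setIidPl; rewrite sub1set.
  have -> : [set v] :\: C = set0 by apply/eqP; rewrite setD_eq0 sub1set.
  rewrite set0U eqxx mul1r -{1 2}(setID s C) setUA incidence_joinl //; last first.
    by rewrite !inE vC.
  case: eqP => [e|_]; last by rewrite mulr0 mul0r addr0.
  by case/negP: vI; rewrite e setU11.
have vD : v \notin s :\: C by rewrite !inE negb_and vs orbT.
have -> : [set v] :&: C = set0 by apply/eqP; rewrite setI_eq0 disjoints1.
have -> : [set v] :\: C = [set v] by apply/setDidPl; rewrite disjoints1.
rewrite set0U eqxx mulr1 -{1 2}(setID s C) setUCA incidence_joinr //; last first.
  by rewrite !inE negb_and vC orbT.
case: eqP => [e|_]; last by rewrite mul0r add0r.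
by case/negP: vD; rewrite e setU11.
Qed.

(** The product of A with the cone of B is exact because its columns are.  The
    product of A and B is a subcomplex, and the quotient is a direct sum of
    copies of A, one for each cohomology class of B, shifted by the degree of the
    class. *)
Lemma coh_dim_join k : coh_dim eps card join k =
  (\sum_(i < k.+1) coh_dim eps card A i * coh_dim eps card B (k - i))%N.
Proof.
have /fin_all_exists[z hz] : forall i : 'I_N, exists z : 'I_(coh_dim eps card B i) ->
    {set V} -> K, coh_basis eps card B i z.
  by move=> i; apply/coh_basis_exists/convex_complex/convB; apply: incidence_card.
pose D := totdiff (V := V) (cone_diff z); pose deg := totdeg (V := V) (@cone_lv K V B).
pose S := setX A (cone K B).
pose S' := [set x in S | if x.2 is inl _ then true else false].
have hconv j : convex (row_family S j).
  move=> s t u; rewrite !inE /= => /andP[sA ->] /andP[uA _] st tu.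
  by rewrite (convA sA uA st tu).
have colE s : column S s = if s \in A then cone K B else set0.
  by apply/setP => j; rewrite !inE /=; case: (s \in A); rewrite inE.
have hcol s : is_complex (cone_diff z) (column S s).
  rewrite colE; case: ifP => _; first exact: cone_complex.
  by move=> x y; rewrite inE.
have hcorner (s t : {set V}) (j l : coneT K B) : s \subset t -> (s, j) \in S ->
    (t, l) \in S -> cone_diff z j l != 0 -> (s, l) \in S /\ (t, j) \in S.
  by rewrite !inE /= => _ /andP[-> ->] /andP[-> ->].
have homog := @totdiff_homog K V _ _ _ (cone_homog (z := z)).
have cS : is_complex D S := totdiff_complex hconv hcol hcorner.
have eS i : exact_at D deg S i.
  apply: (totdiff_exact (cone_homog (z := z)) cS) => s i' _.
  rewrite colE; case: ifP => _; first exact: cone_exact.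
  by move=> v _; exists v => y; rewrite inE.
have sS : subcomplex D S' S.
  split=> [|x y]; first by apply/subsetP => x /setIdP[].
  case/setIdP => _ x2 yS /(totdiff_neq0 (cone_homog (z := z))) xy; rewrite inE yS /=.
  case: xy => [[<- _]|[_]] //.
  by case: (x.2) x2 => // b _; case: (y.2) => //= p; rewrite eqxx.
have joinE : coh_dim D deg S' (k + 1) = coh_dim eps card join k.
  pose tw (s : {set V}) := twist (s :&: C) (s :\: C).
  pose f (s : {set V}) : {set V} * coneT K B := (s :&: C, inl (s :\: C)).
  pose g (x : {set V} * coneT K B) := x.1 :|: (if x.2 is inl b then b else set0).
  have fK s : g (f s) = s by rewrite /g /= setID.
  apply: (coh_dim_iso (f := f) (g := g) (sg := tw) (tg := tw)).
  - by move=> s; rewrite !inE => ->; rewrite fK.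
  - move=> [a [b|p]]; rewrite !inE /= ?andbF // andbT => /andP[aA bB].
    have [e1 e2] := split_in (subA aA) (subB bB).
    by rewrite /g /f /= e1 e2 aA bB.
  - by move=> s _; apply: twist_neq0.
  - by move=> s _; apply: twist_neq0.
  - by move=> s t _ _; rewrite [LHS]incidence_join /D /totdiff /=.
  by move=> s _; rewrite /deg /totdeg /= addnS cardsID addn1.
have quoP x : x \in S :\: S' -> exists p, x.2 = inr p.
  by case/setDP => xS; rewrite inE xS; case: (x.2) => // p _; exists p.
have quoE : coh_dim D deg (S :\: S') k =
    (\sum_(i < N | (i <= k)%N) coh_dim eps card A (k - i) * coh_dim eps card B i)%N.
  have fibE (p : {i : 'I_N & 'I_(coh_dim eps card B i)}) :
      coh_dim D deg [set x in S :\: S' | x.2 == inr p] k =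
      (if tag p <= k then coh_dim eps card A (k - tag p) else 0)%N.
    have lvE x : x \in [set x in S :\: S' | x.2 == inr p] ->
        deg x = (#|x.1| + tag p)%N.
      by rewrite /deg /totdeg inE => /andP[_ /eqP->].
    case: leqP => [pk|pk]; last first.
      apply: coh_dim_level0 => x /lvE ->; rewrite neq_ltn; apply/orP; right.
      by rewrite ltn_addl.
    rewrite -{1}(subnK pk).
    apply: (coh_dim_iso (f := fun a => (a, inr p)) (g := fst) (sg := fun=> 1)
      (tg := fun=> 1)) => //.
    - by move=> a aA; rewrite !inE aA eqxx.
    - move=> [a j]; rewrite !inE /= => /andP[/andP[_ /andP[aA _]] /eqP->].
      by rewrite aA.
    - by move=> a _; apply: oner_neq0.
    - by move=> a _; apply: oner_neq0.
    by move=> a b _ _; rewrite /D (totdiff_snd (cone_homog (z := z))) !mul1r.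
  rewrite (coh_dim_fibres homog (f := snd)); first last.
  - move=> x y /quoP[p xp] /quoP[q yq].
    by case/(totdiff_neq0 (cone_homog (z := z))) => [[]|[_]] //; rewrite xp yq eqxx.
  - exact: complex_quo sS cS.
  rewrite big_sumType /= big1 ?add0n => [|b _]; last first.
    by apply: coh_dim_level0 => x /setIdP[/quoP[p ->]].
  under eq_bigr do rewrite fibE.
  transitivity (\sum_(i < N) \sum_(l < coh_dim eps card B i)
      (if i <= k then coh_dim eps card A (k - i) else 0))%N.
    by rewrite sig_big_dep; apply: eq_bigr => -[].
  rewrite [RHS]big_mkcond; apply: eq_bigr => i _; rewrite sum_nat_const card_ord.
  by case: leqP => _; rewrite ?muln0 // mulnC.
rewrite -joinE addn1.
rewrite -(coh_dim_connect homog cS sS (eS _) (eS _)) quoE.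
rewrite [RHS](reindex_inj rev_ord_inj) /=.
pose F i := (coh_dim eps card A (k - i) * coh_dim eps card B i)%N.
rewrite (eq_bigr (fun i : 'I_k.+1 => F i)) => [|i _]; last first.
  by rewrite subSS /F subKn // -ltnS.
rewrite (big_ord_widen_cond (N + k.+1) (fun i => (i <= k)%N) F) ?leq_addr //.
rewrite (big_ord_widen (N + k.+1) F) ?leq_addl // [RHS](bigID (fun i : 'I__ => (i < N)%N)) /=.
rewrite [X in _ = (_ + X)%N]big1 ?addn0 => [|i /andP[_ iN]].
  by apply: eq_bigl => i; rewrite ltnS.
rewrite /F [X in (_ * X)%N]coh_dim_level0 ?muln0 // => s _.
by rewrite neq_ltn; apply/orP; left; rewrite (leq_ltn_trans (max_card _)) // ltnNge -ltnS.
Qed.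

Lemma coh_poly_join : coh_poly K join = coh_poly K A * coh_poly K B.
Proof.
apply/polyP => k; rewrite coef_coh_poly coefM coh_dim_join natr_sum.
by apply: eq_bigr => i _; rewrite natrM !coef_coh_poly.
Qed.

End Kunneth.
(** * Squarefree degrees and strands of homogeneous matrices *)
Section Monomials.
Variables (K : fieldType) (V : finType).
Implicit Types (s t : {set V}) (m d e : {cmonom V}).

Definition msup m : {set V} := [set v | m v != 0%N].

Lemma supp_degE s v : supp_deg s v = (v \in s).
Proof.
rewrite /supp_deg (big_morph (fun m : {cmonom V} => m v) (cmM v) (cm1 v)).
rewrite (eq_bigr (fun w => (w == v) : nat)) => [|w _]; last by rewrite cmU.
have [vs|vs] := boolP (v \in s).
  rewrite (bigD1 v) //= eqxx big1 ?addn0 // => w /andP[_ wv].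
  by rewrite (negbTE wv).
by rewrite big1 // => w ws; case: eqP => // wv; rewrite -wv ws in vs.
Qed.

Lemma cmonomP m d : (forall v, m v = d v) -> m = d.
Proof. by move=> md; apply/eqP/cmP. Qed.

Lemma msup_supp_deg s : msup (supp_deg s) = s.
Proof. by apply/setP => v; rewrite inE supp_degE; case: (v \in s). Qed.

Lemma mmul_inj d : injective (mmul^~ d).
Proof.
move=> m m' /(congr1 (fun x : {cmonom V} => fun v => x v)) e.
apply: cmonomP => v; have := congr1 (fun f => f v) e; rewrite /= !cmM.
exact: addIn.
Qed.

(** A degree that divides x^s, necessarily squarefree. *)
Definition divides_supp s d := (d == supp_deg (msup d)) && (msup d \subset s).

Lemma divides_suppP s d m : mmul m d = supp_deg s ->
  divides_supp s d /\ m = supp_deg (s :\: msup d).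
Proof.
move=> md; have mdv v : (m v + d v)%N = (v \in s).
  by rewrite -cmM md supp_degE.
have dv v : d v = (v \in msup d).
  by rewrite inE; have := mdv v; case: (v \in s); case: (d v) => // -[|n] //; rewrite ?addnS.
split.
  apply/andP; split; first by apply/eqP/cmonomP => v; rewrite supp_degE -dv.
  apply/subsetP => v; rewrite inE; have := mdv v; case: (v \in s) => //.
  by move/eqP; rewrite addn_eq0 => /andP[_ ->].
apply: cmonomP => v; rewrite supp_degE inE -[v \notin _]/(~~ _).
have := mdv v; rewrite dv; case: (v \in msup d); case: (v \in s); rewrite /= ?addn1 ?addn0 //.
by move=> [].
Qed.

Lemma supp_deg_mul s t : t \subset s ->
  mmul (supp_deg (s :\: t)) (supp_deg t) = supp_deg s.
Proof.
move=> ts; apply: cmonomP => v; rewrite cmM !supp_degE inE.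
by have := subsetP ts v; case: (v \in t) => [->|] //; rewrite addn0.
Qed.

Lemma divides_supp_mul s d : divides_supp s d ->
  mmul (supp_deg (s :\: msup d)) d = supp_deg s.
Proof. by move=> /andP[/eqP e ds]; rewrite [X in mmul _ X]e supp_deg_mul. Qed.

Lemma divides_supp_trans s d e : divides_supp s d -> divides_supp (msup d) e ->
  divides_supp s e.
Proof.
by move=> /andP[_ ds] /andP[ee es]; rewrite /divides_supp ee (subset_trans es).
Qed.

Lemma supp_deg_diff_mul s t (r : {set V}) : r \subset t -> t \subset s ->
  mmul (supp_deg (s :\: t)) (supp_deg (t :\: r)) = supp_deg (s :\: r).
Proof.
move=> /subsetP rt /subsetP ts; apply: cmonomP => v; rewrite cmM !supp_degE !inE.
have := rt v; have := ts v; case: (v \in r) => [_ ->|] //.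
by case: (v \in t) => [->|] //; rewrite addn0.
Qed.

Lemma monomM a b m d : << a *g m >> * << b *g d >> = << a * b *g mmul m d >> :> polyring K V.
Proof. by rewrite malgM_def fgmulUU. Qed.

Lemma mcoeffMU (g : polyring K V) a m d :
  (g * << a *g d >>)@_(mmul m d) = g@_m * a.
Proof.
rewrite {1}(monalgE g) mulr_suml raddf_sum /=.
under eq_bigr do rewrite monomM mcoeffU (inj_eq (@mmul_inj d)).
have [mg|mg] := boolP (m \in msupp g).
  rewrite (bigD1_seq m) ?fset_uniq //= eqxx mulr1n big1 ?addr0 // => m' m'm.
  by rewrite (negbTE m'm) mulr0n.
rewrite (mcoeff_outdom mg) mul0r big1_seq // => m' /andP[_ m'g].
by case: eqP => [e|_]; rewrite ?mulr0n //; rewrite -e m'g in mg.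
Qed.

Lemma mcoeffMU0 (g : polyring K V) a m d : (forall m', mmul m' d <> m) ->
  (g * << a *g d >>)@_m = 0.
Proof.
move=> no; rewrite (monalgE g) mulr_suml raddf_sum /= big1 // => m' _.
by rewrite monomM mcoeffU; case: eqP => [/no|_] //; rewrite mulr0n.
Qed.

Section HomogeneousMatrix.
Variables (a b : nat) (M : 'M[polyring K V]_(a, b)).
Variables (da : 'I_a -> {cmonom V}) (db : 'I_b -> {cmonom V}).
Hypothesis homM : forall j l m, (M j l)@_m != 0 -> mmul m (db l) = da j.

(** The element of degree x^s of a free module with generators in degrees dn that
    has the coefficients v; generators whose degree does not divide x^s are
    absent. *)
Definition strand n (dn : 'I_n -> {cmonom V}) s (v : 'I_n -> K) :
    'rV[polyring K V]_n :=
  \row_j (if divides_supp s (dn j)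
          then << v j *g supp_deg (s :\: msup (dn j)) >> else 0).

(** The scalar that M induces from generator j to generator l in any degree x^s
    divisible by the degree of j. *)
Definition strand_coef (j : 'I_a) (l : 'I_b) : K :=
  if divides_supp (msup (da j)) (db l)
  then (M j l)@_(supp_deg (msup (da j) :\: msup (db l))) else 0.

Lemma homog_monom j l : M j l = 0 \/
  exists2 m, M j l = << (M j l)@_m *g m >> & mmul m (db l) = da j.
Proof.
have [->|] := eqVneq (M j l) 0; first by left.
rewrite -msupp_eq0 => /fset0Pn[m mM]; right; exists m; last first.
  by apply: homM; rewrite mcoeff_neq0.
apply/malgP => m'; rewrite mcoeffU; case: eqP => [->|mm']; rewrite ?mulr1n // mulr0n.
apply/eqP; apply: contraT => /homM e; case: mm'; apply: (@mmul_inj (db l)).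
by rewrite e; apply: homM; rewrite mcoeff_neq0.
Qed.

Lemma homog_strand s j l : divides_supp s (da j) ->
  M j l = << strand_coef j l *g supp_deg (msup (da j) :\: msup (db l)) >>.
Proof.
move=> /andP[/eqP ej _]; rewrite /strand_coef.
have [->|[m ->]] := homog_monom j l; first by rewrite mcoeff0 if_same monalgU0.
rewrite {1}ej => /divides_suppP[-> mE].
by rewrite -mE mcoeffUU.
Qed.

Lemma strand_coef_div s j l : divides_supp s (da j) -> strand_coef j l != 0 ->
  divides_supp s (db l).
Proof.
rewrite /strand_coef; case: ifP => [jl sj _|]; last by rewrite eqxx.
exact: divides_supp_trans jl.
Qed.

(** Restricted to degree x^s, a homogeneous matrix is the scalar matrix of its
    coefficients. *)
Lemma strand_mul s (v : 'I_a -> K) :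
  strand da s v *m M = strand db s
    (fun l => \sum_(j | divides_supp s (da j)) v j * strand_coef j l).
Proof.
apply/rowP => l; rewrite !mxE.
rewrite (bigID (fun j => divides_supp s (da j))) /= [X in _ + X]big1 ?addr0; last first.
  by move=> j /negbTE sj; rewrite mxE sj mul0r.
case: ifP => sl.
  rewrite (raddf_sum (@mkmalgU _ K _)) /=; apply: eq_bigr => j sj.
  rewrite mxE sj (homog_strand l sj) monomM.
  have [->|c0] := eqVneq (strand_coef j l) 0; first by rewrite !mulr0 !monalgU0.
  rewrite (@supp_deg_diff_mul s (msup (da j)) (msup (db l))) //; last by case/andP: sj.
  by move: c0; rewrite /strand_coef; case: ifP => [/andP[]|]; rewrite ?eqxx.
apply: big1 => j sj; rewrite mxE sj (homog_strand l sj).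
have [->|/(strand_coef_div sj)] := eqVneq (strand_coef j l) 0.
  by rewrite monalgU0 mulr0.
by rewrite sl.
Qed.

(** A preimage of an element of degree x^s may have components of other degrees;
    its component of degree x^s suffices. *)
Lemma strand_coeff s (w : 'rV[polyring K V]_a) l : divides_supp s (db l) ->
  ((w *m M) 0 l)@_(supp_deg (s :\: msup (db l))) =
  \sum_(j | divides_supp s (da j))
     (w 0 j)@_(supp_deg (s :\: msup (da j))) * strand_coef j l.
Proof.
move=> sl; rewrite mxE raddf_sum /= [RHS]big_mkcond; apply: eq_bigr => j _.
have [sj|sj] := ifP.
  rewrite (homog_strand l sj).
  have [->|c0] := eqVneq (strand_coef j l) 0; first by rewrite monalgU0 !mulr0 mcoeff0.
  rewrite -(@supp_deg_diff_mul s (msup (da j))) ?mcoeffMU //; last by case/andP: sj.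
  by move: c0; rewrite /strand_coef; case: ifP => [/andP[]|]; rewrite ?eqxx.
have [->|[m -> mE]] := homog_monom j l; first by rewrite mulr0 mcoeff0.
apply: mcoeffMU0 => m' m'm; move/negP: sj; apply.
have : mmul m' (da j) = supp_deg s.
  by rewrite -mE mulmA m'm divides_supp_mul.
by case/divides_suppP.
Qed.

Lemma strand_eq0 s v : strand da s v = 0 -> forall j, divides_supp s (da j) -> v j = 0.
Proof.
move=> e j sj; have /rowP/(_ j) := e; rewrite !mxE sj => /eqP.
by rewrite monalgU_eq0 => /eqP.
Qed.

End HomogeneousMatrix.
End Monomials.
(** * Tor from the strands of a free resolution *)
Section StrandComplex.
Variables (K : fieldType) (V : finType).

Lemma strand_ext n (dn : 'I_n -> {cmonom V}) (s : {set V}) (v w : 'I_n -> K) :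
  (forall j, divides_supp s (dn j) -> v j = w j) -> strand dn s v = strand dn s w.
Proof.
move=> vw; apply/rowP => j; rewrite [LHS]mxE [RHS]mxE.
by case: (divides_supp s (dn j)) (vw j) => [->|].
Qed.

Lemma strand0 n (dn : 'I_n -> {cmonom V}) (s : {set V}) :
  strand dn s (fun=> 0 : K) = 0.
Proof. by apply/rowP => j; rewrite !mxE monalgU0 if_same. Qed.

Lemma strand_mcoeff n (dn : 'I_n -> {cmonom V}) (s : {set V}) (v : 'I_n -> K) j :
  divides_supp s (dn j) ->
  (strand dn s v 0 j)@_(supp_deg (s :\: msup (dn j))) = v j.
Proof. by move=> sj; rewrite mxE sj mcoeffUU. Qed.

Lemma strand_coef_comp (a b c : nat) (da : 'I_a -> {cmonom V})
    (db : 'I_b -> {cmonom V}) (dc : 'I_c -> {cmonom V})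
    (M1 : 'M[polyring K V]_(a, b)) (M2 : 'M[polyring K V]_(b, c)) s i l :
  (forall j l m, (M1 j l)@_m != 0 -> mmul m (db l) = da j) ->
  (forall j l m, (M2 j l)@_m != 0 -> mmul m (dc l) = db j) ->
  M1 *m M2 = 0 -> divides_supp s (da i) -> divides_supp s (dc l) ->
  \sum_(j | divides_supp s (db j))
     strand_coef M1 da db i j * strand_coef M2 db dc j l = 0.
Proof.
move=> h1 h2 M12 si sl.
apply: (strand_eq0 (da := dc) (s := s) (v := fun l =>
  \sum_(j | divides_supp s (db j))
     strand_coef M1 da db i j * strand_coef M2 db dc j l)) => //.
rewrite -(strand_mul h2).
rewrite (@strand_ext _ _ _ _ (fun j => \sum_(i' | divides_supp s (da i'))
   (i' == i)%:R * strand_coef M1 da db i' j)).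
  by rewrite -(strand_mul h1) -mulmxA M12 mulmx0.
move=> j _; rewrite (bigD1 i) //= eqxx mul1r big1 ?addr0 // => i' /andP[_ i'i].
by rewrite (negbTE i'i) mul0r.
Qed.

End StrandComplex.

Section Resolution.
Variables (K : fieldType) (V : finType) (I : polyring K V -> Prop).
Variables (F : mgfree_resolution I) (R : {set V}) (U : {set {set V}}).
Hypothesis memU : forall s, s \in U <-> s \subset R /\ I << supp_deg s >>.

Local Notation eps := (@incidence K V).
Local Notation card := (fun s : {set V} => #|s|).
Local Notation N := #|R|.+1.
Local Notation rk := (mfr_rank F).

Lemma ideal_mul (f g : polyring K V) : I f -> I (g * f).
Proof.
move=> /mfr_aug_onto -/(_ F)[v ->]; apply/(mfr_aug_onto F).
by exists (g *: v); rewrite -scalemxAl [RHS]mxE.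
Qed.

Lemma mfr_diff_diff i : mfr_diff F i.+1 *m mfr_diff F i = 0.
Proof.
apply/row_matrixP => j; rewrite row_mul row0; apply/mfr_exactS.
by exists (delta_mx 0 j); rewrite -rowE.
Qed.

Lemma mfr_diff_aug : mfr_diff F 0 *m mfr_aug F = 0.
Proof.
apply/row_matrixP => j; rewrite row_mul row0; apply/mfr_exact0.
by exists (delta_mx 0 j); rewrite -rowE.
Qed.

Lemma aug_homog (j : 'I_(rk 0)) (l : 'I_1) m :
  (mfr_aug F j l)@_m != 0 -> mmul m mone = mfr_deg j.
Proof. by rewrite (ord1 l) mulm1 => /mfr_aug_homog. Qed.

Lemma msup1 : msup mone = set0 :> {set V}.
Proof. by apply/setP => v; rewrite !inE cm1. Qed.

Lemma divides_supp1 (s : {set V}) : divides_supp s mone.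
Proof.
rewrite /divides_supp msup1 sub0set andbT; apply/eqP/cmonomP => v.
by rewrite supp_degE inE cm1.
Qed.

(** The generators of F in homological degrees below N = |R| + 1, and [None] for
    the ideal itself.  The Betti numbers in question have index less than |R|, so
    they depend on homological degrees at most |R| only. *)
Definition resT : finType := option {i : 'I_N & 'I_(rk i)}.

Definition gen i (h : (i < N)%N) (j : 'I_(rk i)) : resT :=
  Some (@Tagged _ (Ordinal h) (fun i : 'I_N => 'I_(rk i)) j).

Definition diff_coef i := strand_coef (mfr_diff F i) (@mfr_deg _ _ _ F i.+1)
  (@mfr_deg _ _ _ F i).
Definition aug_coef j := strand_coef (mfr_aug F) (@mfr_deg _ _ _ F 0) (fun=> mone) j 0.

(** The equality test between homological degrees yields the cast between the
    index types of the generators. *)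
Definition resdiff (x y : resT) : K :=
  match x, y with
  | Some p, Some q =>
      if (tag p : nat) =P (tag q).+1 is ReflectT e
      then diff_coef (cast_ord (congr1 rk e) (tagged p)) (tagged q) else 0
  | Some p, None =>
      if (tag p : nat) =P 0%N is ReflectT e
      then aug_coef (cast_ord (congr1 rk e) (tagged p)) else 0
  | None, _ => 0
  end.

(** Homological degree counted downwards, so that the differential raises it. *)
Definition reslv (x : resT) : nat := if x is Some p then (N - tag p)%N else N.+1.

Definition respres (s : {set V}) (x : resT) : bool :=
  if x is Some p then divides_supp s (mfr_deg (tagged p)) else s \in U.

(** The part of the augmented resolution in degree x^s. *)
Definition rescol s : {set resT} := [set x | respres s x].

Lemma genP (x : resT) : x = None \/ exists i h j, x = @gen i h j.
Proof.
case: x => [[[i h] j]|]; [right|by left].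
by exists i, h, j.
Qed.

Lemma gen_inj i h : injective (@gen i h).
Proof. by move=> j l /Some_inj/eqP; rewrite eq_Tagged => /eqP. Qed.

Lemma gen_irr i (h h' : (i < N)%N) : @gen i h = gen h'.
Proof. by rewrite (bool_irrelevance h h'). Qed.

Lemma resdiff_gen i h h' j l : resdiff (@gen i.+1 h j) (@gen i h' l) = diff_coef j l.
Proof. by rewrite /=; case: eqP => // e; congr (diff_coef _ _); apply: val_inj. Qed.

Lemma resdiff_aug h j : resdiff (@gen 0 h j) None = aug_coef j.
Proof. by rewrite /=; case: eqP => // e; congr (aug_coef _); apply: val_inj. Qed.

Lemma resdiff_neq0_gen x i h' l : resdiff x (@gen i h' l) != 0 ->
  exists (h : (i.+1 < N)%N) j, x = gen h j.
Proof.
case: (genP x) => [->|[i' [h [j ->]]]] /=; first by rewrite eqxx.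
case: eqP => [e _|]; last by rewrite eqxx.
by subst i'; exists h, j.
Qed.

Lemma resdiff_neq0_None x : resdiff x None != 0 ->
  exists (h : (0 < N)%N) j, x = gen h j.
Proof.
case: (genP x) => [->|[i' [h [j ->]]]] /=; first by rewrite eqxx.
case: eqP => [e _|]; last by rewrite eqxx.
by subst i'; exists h, j.
Qed.

Lemma resdiff_homog x y : resdiff x y != 0 -> reslv y = (reslv x).+1.
Proof.
case: (genP y) => [->|[i [h [l ->]]]].
  by case/resdiff_neq0_None => h [j ->]; rewrite /= subn0.
by case/resdiff_neq0_gen => h' [j ->] /=; rewrite subnSK.
Qed.

Lemma rescol_sum s i (h : (i < N)%N) (f : resT -> K) :
  (forall x, f x != 0 -> exists j, x = gen h j) ->
  \sum_(x in rescol s) f x =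
  \sum_(j | divides_supp s (@mfr_deg _ _ _ F i j)) f (gen h j).
Proof.
move=> f0.
rewrite (sum_embed (A := [set j | divides_supp s (mfr_deg j)]) (h := gen h)).
- by apply: eq_bigl => j; rewrite inE.
- exact: gen_inj.
- by move=> j; rewrite !inE.
move=> x xs xg; apply/eqP; apply: contraNT xg => /f0[j xj].
by rewrite xj; apply: imset_f; rewrite xj !inE in xs *.
Qed.

Lemma coapp_gen s v i (h : (i.+1 < N)%N) h' l :
  coapp resdiff (rescol s) v (@gen i h' l) =
  \sum_(j | divides_supp s (mfr_deg j)) v (gen h j) * diff_coef j l.
Proof.
rewrite /coapp (rescol_sum s (h := h)).
  by apply: eq_bigr => j _; rewrite resdiff_gen.
move=> x; rewrite mulf_eq0 negb_or => /andP[_ /resdiff_neq0_gen[h1 [j ->]]].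
by exists j; rewrite (gen_irr h1 h).
Qed.

Lemma coapp_top s v i h' l : (N <= i.+1)%N ->
  coapp resdiff (rescol s) v (@gen i h' l) = 0.
Proof.
move=> Ni; apply: big1 => x _; apply/eqP; rewrite mulf_eq0; apply/orP; right.
by apply: contraT => /resdiff_neq0_gen[h1 _]; rewrite ltnNge Ni in h1.
Qed.

Lemma coapp_aug s v (h : (0 < N)%N) :
  coapp resdiff (rescol s) v None =
  \sum_(j | divides_supp s (mfr_deg j)) v (gen h j) * aug_coef j.
Proof.
rewrite /coapp (rescol_sum s (h := h)).
  by apply: eq_bigr => j _; rewrite resdiff_aug.
move=> x; rewrite mulf_eq0 negb_or => /andP[_ /resdiff_neq0_None[h1 [j ->]]].
by exists j; rewrite (gen_irr h1 h).
Qed.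

Lemma rescol_complex s : is_complex resdiff (rescol s).
Proof.
move=> x z xs zs; rewrite -[LHS]/(coapp resdiff (rescol s) (resdiff x) z).
case: (genP z) zs => [->|[i [h [l ->]]]]; rewrite !inE /= => zs.
  have h0 : (0 < N)%N by []; rewrite (coapp_aug _ _ h0).
  have [/existsP[j xj]|no] := boolP [exists j, resdiff x (gen h0 j) != 0]; last first.
    rewrite big1 // => j _; apply/eqP; rewrite mulf_eq0; apply/orP; left.
    by apply: contraNT no => xj; apply/existsP; exists j.
  have [h1 [i ex]] := resdiff_neq0_gen xj; rewrite ex inE in xs.
  rewrite (eq_bigr (fun j0 => diff_coef i j0 * aug_coef j0)) => [|j0 _]; last first.
    by rewrite ex resdiff_gen.
  exact: (strand_coef_comp (@mfr_diff_homog _ _ _ F 0) aug_homog mfr_diff_aug xs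
    (divides_supp1 s)).
have [h1|/coapp_top-> //] := ltnP i.+1 N; rewrite (coapp_gen _ _ h1).
have [/existsP[j xj]|no] := boolP [exists j, resdiff x (gen h1 j) != 0]; last first.
  rewrite big1 // => j _; apply/eqP; rewrite mulf_eq0; apply/orP; left.
  by apply: contraNT no => xj; apply/existsP; exists j.
have [h2 [j' ex]] := resdiff_neq0_gen xj; rewrite ex inE in xs.
rewrite (eq_bigr (fun j0 => diff_coef j' j0 * diff_coef j0 l)) => [|j0 _]; last first.
  by rewrite ex resdiff_gen.
exact: (strand_coef_comp (@mfr_diff_homog _ _ _ F i.+1) (@mfr_diff_homog _ _ _ F i)
  (mfr_diff_diff i) xs zs).
Qed.

Definition lift_gen i (w : 'I_(rk i) -> K) (x : resT) : K :=
  if x is Some p then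
    if (tag p : nat) =P i is ReflectT e then w (cast_ord (congr1 rk e) (tagged p))
    else 0
  else 0.

Lemma lift_genE i (w : 'I_(rk i) -> K) h j : lift_gen w (gen h j) = w j.
Proof. by rewrite /=; case: eqP => // e; congr (w _); apply: val_inj. Qed.

(** The image of the generator is a nonzero multiple of a monomial that divides
    x^s. *)
Lemma aug_coef_mem (s : {set V}) j : s \subset R -> divides_supp s (mfr_deg j) ->
  aug_coef j != 0 -> s \in U.
Proof.
move=> sR sj aj; apply/memU; split=> //.
have augI : I (mfr_aug F j 0).
  apply/(mfr_aug_onto F); exists (delta_mx 0 j).
  by rewrite -rowE mxE.
have e := homog_strand (@aug_homog) 0 sj; rewrite e in augI.
have := ideal_mul << (aug_coef j)^-1 *g supp_deg (s :\: msup (mfr_deg j)) >> augI.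
rewrite monomM (mulVf aj) supp_deg_diff_mul; first by rewrite msup1 setD0.
  by rewrite msup1 sub0set.
by case/andP: sj.
Qed.

(** Exactness of F over the polynomial ring, read off in degree x^s.  Level 1 is
    the truncated end of the resolution. *)
Lemma rescol_exact (s : {set V}) k : s \subset R -> (1 < k)%N ->
  exact_at resdiff reslv (rescol s) k.
Proof.
move=> sR k1 v vS; have h0 : (0 < N)%N by [].
have [kN|kN|kN] := ltngtP k N.+1.
- have lvE i h j : reslv (@gen i h j) = k -> i = (N - k)%N.
    by move=> <-; rewrite /= subKn // ltnW.
  have h1 : ((N - k).+1 < N)%N.
    by rewrite -(subSn (kN : (k <= N)%N)) (ltn_subLR _ (ltnW kN)) -[N.+1]add1n ltn_add2r.
  pose i := (N - k)%N; have h : (i < N)%N := ltnW h1.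
  pose u (j : 'I_(rk i)) := v (gen h j).
  have [w uw] : exists w, strand (@mfr_deg _ _ _ F i) s u = w *m mfr_diff F i.
    have : (N - i = k)%N by rewrite subKn.
    rewrite {}/u; move: h h1; rewrite -/i; clearbody i; case: i => [|i] h h1 ik.
      apply/mfr_exact0; rewrite (strand_mul aug_homog) -[RHS](strand0 K (fun _ : 'I_1 => mone) s).
      apply: strand_ext => l _; rewrite (ord1 l) -(coapp_aug _ v).
      have [sU|sU] := boolP (s \in U).
        by apply: vS; rewrite ?inE //= -ik subn0.
      rewrite (coapp_aug _ _ h) big1 // => j sj; apply/eqP; rewrite mulf_eq0.
      by apply/orP; right; apply: contraNT sU; apply: aug_coef_mem.
    apply/mfr_exactS; rewrite (strand_mul (@mfr_diff_homog _ _ _ F i)).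
    rewrite -[RHS](strand0 K (@mfr_deg _ _ _ F i) s).
    apply: strand_ext => l sl; rewrite -(coapp_gen _ v h (ltnW h)).
    by apply: vS; [rewrite inE | rewrite /= -ik subnSK // ltnW].
  exists (lift_gen (fun j => (w 0 j)@_(supp_deg (s :\: msup (mfr_deg j))))) => x.
  case: (genP x) => [->|[i' [h' [j ->]]]] xs lx.
    by move: kN; rewrite -lx ltnn.
  have e := lvE _ _ _ lx; rewrite -/i in e; subst i'.
  rewrite (coapp_gen _ _ h1) inE in xs *.
  rewrite (gen_irr h' h) -/(u j) -(strand_mcoeff u xs) uw.
  rewrite (strand_coeff (@mfr_diff_homog _ _ _ F i)) //.
  by apply: eq_bigr => j' _; rewrite lift_genE.
- exists (fun=> 0) => x _ lx; move: kN; rewrite -lx.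
  by case: x {lx} => [p|] /=; rewrite ?ltnn // ltnNge (leq_trans (leq_subr _ _)).
have [sU|sU] := boolP (s \in U); last first.
  exists (fun=> 0) => x; case: (genP x) => [->|[i [h [j ->]]]].
    by rewrite inE /= (negbTE sU).
  by move=> _ /= e; have := leq_subr i N; rewrite e kN ltnn.
have [_ /(mfr_aug_onto F)[w we]] := (memU s).1 sU.
exists (lift_gen (fun j => v None * (w 0 j)@_(supp_deg (s :\: msup (mfr_deg j))))) => x.
case: (genP x) => [->|[i [h [j ->]]]]; last first.
  by move=> _ /= e; have := leq_subr i N; rewrite e kN ltnn.
move=> _ _; rewrite (coapp_aug _ _ h0).
under eq_bigr do rewrite lift_genE -mulrA.
rewrite -mulr_sumr -(strand_coeff aug_homog); last exact: divides_supp1.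
by rewrite -we msup1 setD0 mcoeffUU mulr1.
Qed.

Lemma U_up (s t : {set V}) : s \in U -> s \subset t -> t \subset R -> t \in U.
Proof.
move=> /memU[_ Is] st tR; apply/memU; split; first exact: tR.
have := ideal_mul << supp_deg (t :\: s) >> Is.
rewrite monomM mulr1 (supp_deg_mul st); exact.
Qed.

Lemma respres_mono (s t : {set V}) x : s \subset t -> t \subset R -> respres s x -> respres t x.
Proof.
move=> st tR; case: x => [p|] /=; last by move=> sU; exact: U_up sU st tR.
by case/andP=> e ps; rewrite /divides_supp e (subset_trans ps).
Qed.

Lemma respres_diff (s : {set V}) x y : s \subset R -> respres s x -> resdiff x y != 0 ->
  respres s y.
Proof.
move=> sR sx; case: (genP y) => [->|[i [h [l ->]]]].
  move=> xy; have [h0 [j ex]] := resdiff_neq0_None xy; rewrite ex in sx xy.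
  rewrite resdiff_aug in xy; exact: aug_coef_mem xy.
move=> xy; have [h1 [j ex]] := resdiff_neq0_gen xy; rewrite ex in sx xy.
rewrite resdiff_gen in xy; exact: strand_coef_div sx xy.
Qed.

Definition restot : {set {set V} * resT} :=
  [set x : {set V} * resT | (x.1 \subset R) && respres x.1 x.2].

Local Notation D := (totdiff (V := V) resdiff).
Local Notation deg := (totdeg (V := V) reslv).

Lemma restot_column (s : {set V}) : column restot s = if s \subset R then rescol s else set0.
Proof. by apply/setP => x; rewrite !inE /=; case: ifP; rewrite inE. Qed.

Lemma restot_complex : is_complex D restot.
Proof.
apply: totdiff_complex.
- move=> x s t u; rewrite !inE /= => /andP[_ sx] /andP[uR _] st tu.
  have tR := subset_trans tu uR; rewrite tR; exact: respres_mono sx.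
- move=> s; rewrite restot_column; case: ifP => _; first exact: rescol_complex.
  by move=> x y; rewrite inE.
move=> s t x y st; rewrite !inE /= => /andP[sR sx] /andP[tR ty] xy.
by rewrite sR tR (respres_diff sR sx xy) (respres_mono st tR sx).
Qed.

Lemma restot_exact k : (#|R|.+1 < k)%N -> exact_at D deg restot k.
Proof.
move=> Rk; apply: (totdiff_exact resdiff_homog restot_complex) => s i ki.
rewrite restot_column; case: ifP => [sR|_]; last by move=> v _; exists v => y; rewrite inE.
apply: (rescol_exact sR); rewrite -(ltn_add2r #|s|) -ki; apply: leq_trans _ Rk.
by rewrite add1n !ltnS subset_leq_card.
Qed.

(** Among generators whose degree divides x^s, with s inside R, these are the ones
    of degree x^R. *)
Definition restop (x : {set V} * resT) : bool :=
  if x.2 is Some p then msup (mfr_deg (tagged p)) == R else false.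

Definition resbot := [set x in restot | ~~ restop x].
Definition resaug := [set x in resbot | x.2 == None].

Lemma resbot_sub : subcomplex D resbot restot.
Proof.
split=> [|x y]; first by apply/subsetP => x /setIdP[].
case/setIdP=> xS xt yS xy; rewrite inE yS /=; move: xt.
case/(totdiff_neq0 resdiff_homog): xy => [[e _]|[_ xy]]; first by rewrite /restop e.
apply: contra; rewrite /restop.
case: (genP y.2) xy => [->//|[i [h [l ->]]]] xy.
have [h1 [j ex]] := resdiff_neq0_gen xy; rewrite ex resdiff_gen in xy *.
rewrite /= => /eqP lR; rewrite eqEsubset.
move: xS; rewrite inE ex /= => /andP[x1R /andP[_ jx]].
rewrite (subset_trans jx) //=.
by move: xy; rewrite /diff_coef /strand_coef lR; case: ifP => [/andP[_]|]; rewrite ?lR ?eqxx.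
Qed.

Lemma resaug_sub : subcomplex D resaug resbot.
Proof.
split=> [|x y]; first by apply/subsetP => x /setIdP[].
case/setIdP=> _ /eqP x2 yS; rewrite inE yS /=.
by case/(totdiff_neq0 resdiff_homog) => [[<- _]|[_]]; rewrite x2 /= eqxx.
Qed.

Lemma resbot_complex : is_complex D resbot.
Proof. exact: complex_sub resbot_sub restot_complex. Qed.

(** The row of a generator of squarefree degree x^t, t smaller than R, consists of
    all sets between t and R. *)
Lemma resbot_exact k : exact_at D deg (resbot :\: resaug) k.
Proof.
apply: (totdiff_exact_rows resdiff_homog) => [|x i].
  exact: complex_quo resaug_sub resbot_complex.
have rowE s : (s \in row_family (resbot :\: resaug) x) =
    [&& s \subset R, respres s x, ~~ restop (s, x) & x != None].
  by rewrite !inE /=; case: (s \subset R); case: (respres s x); case: (restop _); case: eqP.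
have row0 : (forall s, s \notin row_family (resbot :\: resaug) x) ->
    exact_at eps card (row_family (resbot :\: resaug) x) i.
  by move=> no v _; exists v => s sS; case/negP: (no s).
case: x rowE row0 => [p|] rowE row0; last by apply: row0 => s; rewrite rowE !andbF.
have [e|pR] := eqVneq (msup (mfr_deg (tagged p))) R.
  by apply: row0 => s; rewrite rowE /restop /= e eqxx !andbF.
have {}rowE s : (s \in row_family (resbot :\: resaug) (Some p)) =
    (s \subset R) && divides_supp s (mfr_deg (tagged p)).
  by rewrite rowE /restop /= (negbTE pR) !andbT.
have [RD|/subsetPn[v vR vp]] := boolP (R \subset msup (mfr_deg (tagged p))).
  apply: row0 => s; rewrite rowE; apply/andP => -[sR /andP[_ ps]].
  by case/eqP: pR; apply/eqP; rewrite eqEsubset RD (subset_trans ps sR).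
apply: (toggle_exact (C := set0) (p := fun=> v)).
- move=> s t u; rewrite !rowE => /andP[_ /andP[e ps]] /andP[uR _] st tu.
  by rewrite (subset_trans tu uR) /divides_supp e (subset_trans ps st).
- by move=> s _; rewrite inE.
- move=> s; rewrite !rowE => /andP[sR /andP[e ps]]; rewrite /divides_supp e.
  by rewrite subUset sub1set vR sR (subset_trans ps) ?subsetUr.
move=> s; rewrite !rowE => /andP[sR /andP[e ps]]; rewrite /divides_supp e.
by rewrite (subset_trans (subsetDl _ _) sR) subsetD1 ps vp.
Qed.

Lemma coh_dim_resaug m : coh_dim D deg resaug (m + N.+1) = coh_dim eps card U m.
Proof.
apply: (coh_dim_iso (f := fun s => (s, None)) (g := fst) (sg := fun=> 1) (tg := fun=> 1)).
- by move=> s sU; rewrite !inE /= sU andbT; case/memU: sU => ->.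
- by move=> [s x]; rewrite !inE /= => /andP[/andP[/andP[_ sx] _] /eqP ex]; rewrite ex in sx *.
- by move=> s _; apply: oner_neq0.
- by move=> s _; apply: oner_neq0.
- by move=> s t _ _; rewrite (totdiff_snd resdiff_homog) !mul1r.
by [].
Qed.

Definition topgen i (h : (i < N)%N) (j : 'I_(rk i)) : {set V} * resT := (R, gen h j).

Lemma topgen_inj i h : injective (@topgen i h).
Proof. by move=> j l /(congr1 snd)/gen_inj. Qed.

Lemma restot_topP x : x \in restot :\: resbot ->
  exists i (h : (i < N)%N) j, x = topgen h j /\ mfr_deg j = supp_deg R.
Proof.
case/setDP => xS; rewrite inE xS negbK; case: x xS => s x; rewrite inE /restop /=.
case: (genP x) => [->//|[i [h [j ->]]]] /= /andP[sR /andP[/eqP dj js] /eqP jR].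
exists i, h, j; rewrite dj jR; split=> //; congr (_, _).
by apply/eqP; rewrite eqEsubset sR -jR.
Qed.

Lemma topgen_top i (h : (i < N)%N) j : mfr_deg j = supp_deg R ->
  topgen h j \in restot :\: resbot.
Proof.
move=> dj; rewrite !inE /restop /= dj msup_supp_deg.
by rewrite /divides_supp msup_supp_deg !subxx !eqxx.
Qed.

Lemma level_top i (h : (i < N)%N) :
  level deg (restot :\: resbot) (#|R| + (N - i)) =
  topgen h @: mfr_gens F i (supp_deg R).
Proof.
apply/setP => x; apply/idP/imsetP => [|[j jg ->]]; last first.
  rewrite inE in jg; rewrite inE topgen_top ?(eqP jg) //=.
case/setIdP => /restot_topP[i' [h' [j [-> dj]]]]; rewrite /totdeg /= eqn_add2l => /eqP e.
have ii' : i' = i by rewrite -(subKn (ltnW h)) -e subKn // ltnW.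
subst i'; exists j; first by rewrite inE dj.
by rewrite /topgen (gen_irr h' h).
Qed.

Lemma level_top0 : level deg (restot :\: resbot) (#|R| + N).+1 = set0.
Proof.
apply/setP => x; rewrite [RHS]inE; apply/negP => /setIdP[/restot_topP[i [h [j [-> _]]]]].
by rewrite /totdeg /= -addnS eqn_add2l => /eqP e; have := leq_subr i N; rewrite e ltnn.
Qed.

Lemma diff_coef_top i j l : mfr_deg j = supp_deg R -> mfr_deg l = supp_deg R ->
  @diff_coef i j l = (mfr_diff F i j l)@_mone.
Proof.
move=> dj dl; rewrite /diff_coef /strand_coef /divides_supp dj dl msup_supp_deg.
rewrite eqxx subxx /= setDv; congr (mcoeff _ _).
by apply/esym/cmonomP => v; rewrite supp_degE inE cm1.
Qed.

(** Between generators of degree x^R only constant coefficients count, as in the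
    definition of Tor. *)
Lemma rank_top i (h : (i.+1 < N)%N) :
  \rank (incmx D (level deg (restot :\: resbot) (#|R| + (N - i.+1)))
    (level deg (restot :\: resbot) (#|R| + (N - i)))) =
  \rank (tor_diff F i (supp_deg R)).
Proof.
rewrite (level_top h) (level_top (ltnW h)).
rewrite -(rank_incmx_imset (D := fun j l => (mfr_diff F i j l)@_mone)
  (c := (-1) ^+ #|R|)) //.
- by rewrite signr_eq0.
- by move=> ? ? _ _; apply: topgen_inj.
- by move=> ? ? _ _; apply: topgen_inj.
move=> j l; rewrite !inE => /eqP dj /eqP dl.
by rewrite totdiff_fst resdiff_gen diff_coef_top.
Qed.

(** Hochster's formula for squarefree Betti numbers, for any free resolution. *)
Theorem betti_coh_dim i : (i < #|R|)%N ->
  betti F i (supp_deg R) = coh_dim eps card U (#|R| - i).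
Proof.
move=> iR; have h : (i < N)%N := ltnW iR; have h1 : (i.+1 < N)%N := iR.
have homog := @totdiff_homog K V _ _ _ resdiff_homog.
pose k := (#|R| + (N - i))%N.
have kR : (#|R|.+1 < k)%N.
  by rewrite /k -addn1 ltn_add2l ltn_subRL addn1.
rewrite -coh_dim_resaug.
have -> : (#|R| - i + N.+1 = k.+1)%N.
  by rewrite /k addnS (addnBA _ (ltnW h)) addnC addnBA ?(ltnW iR) // addnC.
rewrite (coh_dim_sub homog _ resbot_complex resaug_sub resbot_exact).
rewrite -(coh_dim_connect homog restot_complex resbot_sub (restot_exact kR)
  (restot_exact (leqW kR))).
have card_k : #|level deg (restot :\: resbot) k| = #|mfr_gens F i (supp_deg R)|.
  by rewrite (level_top h) card_imset //; apply: topgen_inj.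
have belowE : below deg (restot :\: resbot) k =
    level deg (restot :\: resbot) (#|R| + (N - i.+1)).
  by rewrite /k -(subnSK h) addnS belowS.
have in_rank : \rank (incmx D (below deg (restot :\: resbot) k)
    (level deg (restot :\: resbot) k)) = \rank (tor_diff F i (supp_deg R)).
  by rewrite belowE rank_top.
have out_rank : \rank (incmx D (level deg (restot :\: resbot) k)
    (level deg (restot :\: resbot) k.+1)) =
    if i is i'.+1 then \rank (tor_diff F i' (supp_deg R)) else 0%N.
  rewrite /k; case: (i) h => [|i'] h'.
    rewrite subn0 level_top0; apply/eqP; rewrite -leqn0.
    by rewrite (leq_trans (rank_leq_col _)) ?cards0.
  by rewrite -addnS subnSK ?rank_top // ltnW.
rewrite /coh_dim homology_dimE in_rank out_rank card_k.
rewrite /betti; case: (i) => [|i']; rewrite homology_dimE //.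
by rewrite mxrank0.
Qed.

End Resolution.
(** * Cancelling parts of a family *)
Section FamilyReduction.
Variables (K : fieldType) (V : finType).
Local Notation eps := (@incidence K V).
Local Notation card := (fun s : {set V} => #|s|).
Implicit Types (s t : {set V}) (S A : {set {set V}}).

Lemma upper_subcomplex S A : A \subset S ->
  (forall s t, s \in A -> t \in S -> s \subset t -> t \in A) ->
  subcomplex eps A S.
Proof. by move=> AS up; split=> // s t sA tS /incidence_sub; apply: up. Qed.

Lemma coh_poly_sub S A : convex S -> A \subset S ->
  (forall s t, s \in A -> t \in S -> s \subset t -> t \in A) ->
  (forall k, exact_at eps card (S :\: A) k) -> coh_poly K A = coh_poly K S.
Proof.
move=> cS AS up eQ; apply/polyP => k; rewrite !coef_coh_poly; congr (_%:R).
apply: (coh_dim_sub (@incidence_card K V)) eQ; first exact: convex_complex.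
exact: upper_subcomplex.
Qed.

Lemma coh_poly_quo S A : convex S -> A \subset S ->
  (forall s t, s \in A -> t \in S -> s \subset t -> t \in A) ->
  (forall k, exact_at eps card A k) -> coh_poly K (S :\: A) = coh_poly K S.
Proof.
move=> cS AS up eA; apply/polyP => k; rewrite !coef_coh_poly; congr (_%:R).
apply: (coh_dim_quo (@incidence_card K V)) (eA k) (eA k.+1).
  exact: convex_complex.
exact: upper_subcomplex.
Qed.

Lemma exact_at_set0 k : exact_at eps card set0 k.
Proof. by move=> v _; exists v => s; rewrite inE. Qed.

End FamilyReduction.

Section SmallFamilies.
Variables (K : fieldType) (V : finType).
Local Notation eps := (@incidence K V).
Local Notation card := (fun s : {set V} => #|s|).

Lemma coh_poly_set1 (s : {set V}) : coh_poly K [set s] = 'X^#|s|.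
Proof.
apply/polyP => k; rewrite coef_coh_poly coefXn; case: eqP => [->|ks].
  have e : level card [set s] #|s| = [set s].
    by apply/setP => t; rewrite !inE; case: eqP => //= ->; rewrite eqxx.
  rewrite /coh_dim homology_dimE.
  have -> : \rank (incmx eps (below card [set s] #|s|) (level card [set s] #|s|)) = 0%N.
    apply/eqP; rewrite -leqn0; apply: leq_trans (rank_leq_row _) _.
    rewrite leqn0 cards_eq0; apply/eqP/setP => t; rewrite !inE.
    by case: (eqVneq t s) => //= ->; rewrite eqn_leq ltnn.
  have -> : \rank (incmx eps (level card [set s] #|s|) (level card [set s] #|s|.+1)) = 0%N.
    apply/eqP; rewrite -leqn0; apply: leq_trans (rank_leq_col _) _.
    rewrite leqn0 cards_eq0; apply/eqP/setP => t; rewrite !inE.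
    by case: (eqVneq t s) => //= ->; rewrite eqn_leq ltnn andbF.
  by rewrite e cards1.
by rewrite coh_dim_level0 // => t; rewrite inE => /eqP->; rewrite eq_sym; apply/eqP.
Qed.

Definition nonempty_sets (B : {set V}) : {set {set V}} :=
  [set a : {set V} | (a \subset B) && (a != set0)].

Lemma nonempty_sets_up B (a b : {set V}) : a \in nonempty_sets B -> a \subset b ->
  b \subset B -> b \in nonempty_sets B.
Proof.
rewrite !inE => /andP[_ /set0Pn[v va]] ab ->.
by apply/set0Pn; exists v; apply: (subsetP ab).
Qed.

(** Toggling v cancels all nonempty sets except the singleton of v. *)
Lemma coh_poly_nonempty (B : {set V}) v : v \in B -> coh_poly K (nonempty_sets B) = 'X.
Proof.
move=> vB; have conv : convex (nonempty_sets B).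
  move=> s t u sS; rewrite [u \in _]inE => /andP[uB _] st tu.
  exact: nonempty_sets_up sS st (subset_trans tu uB).
pose A := [set a in nonempty_sets B | a != [set v]].
have AP a : a \in A -> a \subset B /\ exists2 x, x \in a & x != v.
  case/setIdP; rewrite inE => /andP[aB /set0Pn[x xa]] av; split=> //.
  have [xv|xv] := eqVneq x v; last by exists x.
  have : ~~ (a \subset [set v]).
    by apply: contra av => av; rewrite eqEsubset av sub1set -xv.
  by case/subsetPn => y ya; rewrite inE => yv; exists y.
have AI (a : {set V}) x : a \subset B -> x \in a -> x != v -> a \in A.
  move=> aB xa xv; rewrite !inE aB /=; apply/andP; split.
    by apply/set0Pn; exists x.
  by apply: contraNneq xv => av; move: xa; rewrite av inE.
have up s t : s \in A -> t \in nonempty_sets B -> s \subset t -> t \in A.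
  move=> /AP[_ [x xs xv]]; rewrite inE => /andP[tB _] st.
  exact: AI tB (subsetP st x xs) xv.
have AS : A \subset nonempty_sets B by apply/subsetP => a /setIdP[].
rewrite -(coh_poly_quo conv AS up) => [|k].
  rewrite (_ : _ :\: A = [set [set v]]) ?coh_poly_set1 ?cards1 ?expr1 //.
  apply/setP => a; rewrite in_setD [a \in A]inE [RHS]inE negb_and negbK.
  case: (boolP (a \in nonempty_sets B)) => [_|] /=; first by rewrite andbT.
  move=> aS; apply/esym/negbTE; apply: contra aS => /eqP->.
  by rewrite inE sub1set vB; apply/set0Pn; exists v; rewrite inE.
apply: (toggle_exact (C := set0) (p := fun=> v)).
- move=> s t u sA uA st tu; have [uB _] := AP u uA; have [_ [x xs xv]] := AP s sA.
  exact: AI (subset_trans tu uB) (subsetP st x xs) xv.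
- by move=> s _; rewrite inE.
- move=> s /AP[sB [x xs xv]]; apply: (AI _ x) => //; last by rewrite inE xs orbT.
  by rewrite subUset sub1set vB.
move=> s /AP[sB [x xs xv]]; apply: (AI _ x) => //; last by rewrite !inE xs xv.
exact: subset_trans (subsetDl _ _) sB.
Qed.

End SmallFamilies.

Section Gate.
Variables (K : fieldType) (V : finType).
Local Notation eps := (@incidence K V).
Local Notation card := (fun s : {set V} => #|s|).
Implicit Types (s t : {set V}).

Variables (B C : {set V}) (E : {set V} -> {set V}) (G : {set {set V}}).
Hypothesis BC : [disjoint B & C].
Hypothesis E_mono : forall s t, s \subset t -> E s \subset E t.
Hypothesis G_sub : forall a, a \in G -> a \subset B.
Hypothesis G_up : forall a b : {set V}, a \in G -> a \subset b -> b \subset B -> b \in G.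

(** The common shape of the family of sets that contain a chain and of the families
    that remain when layers are stripped off: G is a condition on the part of s in
    B, of which the part in C lets only some elements count. *)
Definition gated := [set s : {set V} | (s \subset B :|: C) && (s :&: B :&: E (s :&: C) \in G)].
Definition opening := [set c : {set V} | (c \subset C) && (B \subset E c)].

Lemma G_convex : convex G.
Proof. by move=> s t u sG uG st tu; apply: G_up sG st (subset_trans tu (G_sub uG)). Qed.

Lemma opening_convex : convex opening.
Proof.
move=> s t u; rewrite !inE => /andP[_ sE] /andP[uC _] st tu.
by rewrite (subset_trans tu uC) (subset_trans sE (E_mono st)).
Qed.

Lemma gated_convex : convex gated.
Proof.
move=> s t u; rewrite !inE => /andP[_ sG] /andP[uBC _] st tu.
rewrite (subset_trans tu uBC); apply: G_up sG _ _.
  by rewrite setISS ?setSI // E_mono // setSI.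
by rewrite -setIA setIC -setIA subsetIl.
Qed.

(** If some vertex of B is not let through by s :&: C, it can be toggled.  The
    remaining sets, for which everything in B is let through, form a product. *)
Lemma coh_poly_gated : coh_poly K gated = coh_poly K G * coh_poly K opening.
Proof.
pose A := [set s in gated | B \subset E (s :&: C)].
have disjBC x : x \in B -> x \notin C by move=> xB; rewrite (disjointFr BC xB).
have -> : coh_poly K G * coh_poly K opening = coh_poly K A.
  rewrite -(@coh_poly_join K V B G opening) //; first last.
  - move=> c; rewrite inE => /andP[cC _]; apply/subsetP => x xc.
    by rewrite inE; apply: contraL (subsetP cC _ xc); apply: disjBC.
  - exact: opening_convex.
  - exact: G_convex.
  congr (coh_poly K _); apply/setP => s; rewrite !inE.
  have sC : s \subset B :|: C -> s :\: B = s :&: C.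
    move=> sBC; apply/setP => x; rewrite !inE.
    have := subsetP sBC x; rewrite inE; have := disjBC x.
    by case: (x \in s); case: (x \in B); case: (x \in C) => //= h1 h2; rewrite ?h1 // -(h2 _).
  apply/and3P/andP => [[sG sD sE]|[/andP[sBC sG] sE]].
    have sBC : s \subset B :|: C by rewrite -(setID s B) setUSS ?subsetIr.
    rewrite -(sC sBC) sE sBC /=; split=> //.
    by rewrite (setIidPl _) // (subset_trans (subsetIr _ _)).
  rewrite (sC sBC) subsetIr sE; split=> //.
  by move: sG; rewrite (setIidPl _) // (subset_trans (subsetIr _ _)).
apply/esym/coh_poly_sub.
- exact: gated_convex.
- by apply/subsetP => s /setIdP[].
- move=> s t /setIdP[_ sE] tS st; rewrite inE tS /=.
  by rewrite (subset_trans sE) // E_mono // setSI.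
move=> k; have [->|[s0]] := set_0Vmem (gated :\: A); first exact: exact_at_set0.
case/setDP => s0S; rewrite inE s0S => /subsetPn[v0 v0B _].
pose p c := odflt v0 [pick v in B :\: E c].
have pP s : s \in gated :\: A -> p (s :&: C) \in B :\: E (s :&: C).
  case/setDP => sS; rewrite inE sS => /subsetPn[v vB vE].
  by rewrite /p; case: pickP => [//|/(_ v)]; rewrite inE vE vB.
have gatedU s : s \in gated :\: A -> forall t, t :&: C = s :&: C ->
    t :&: B :&: E (s :&: C) = s :&: B :&: E (s :&: C) -> t \subset B :|: C ->
    t \in gated :\: A.
  move=> + t tC tB tBC; rewrite !inE tC tB tBC => /andP[nE /andP[sBC sG]].
  by move: nE; rewrite sBC sG !andbT.
have pC s : s \in gated :\: A -> p (s :&: C) \notin C.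
  by move=> /pP/setDP[/disjBC].
apply: (toggle_exact (C := C) (p := p)) => //.
- move=> s t u /setDP[sS sA] /setDP[uS uA] st tu.
  have tS := gated_convex sS uS st tu; rewrite in_setD tS andbT.
  apply: contra uA => /setIdP[_ tE]; rewrite inE uS /=.
  by rewrite (subset_trans tE) // E_mono // setSI.
- move=> s sS; apply: (gatedU s sS).
  + by rewrite setIUl (_ : [set _] :&: C = set0) ?set0U //; apply/eqP; rewrite setI_eq0 disjoints1 pC.
  + rewrite !setIUl (_ : [set _] :&: B :&: _ = set0) ?set0U //.
    apply/eqP; rewrite -setIA setI_eq0 disjoints1 inE negb_and orbC.
    by case/setDP: (pP s sS) => _ ->.
  rewrite subUset sub1set inE; case/setDP: (pP s sS) => -> _ /=.
  by case/setDP: sS; rewrite inE => /andP[].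
move=> s sS; apply: (gatedU s sS).
+ by rewrite setIDAC; apply/setDidPl; rewrite disjoint_sym disjoints1 inE negb_and pC ?orbT.
+ rewrite !setIDAC; apply/setDidPl; rewrite disjoint_sym disjoints1 inE negb_and orbC.
  by case/setDP: (pP s sS) => _ ->.
apply: subset_trans (subsetDl _ _) _.
by case/setDP: sS; rewrite inE => /andP[].
Qed.

End Gate.
(** * Dominating sets of bipartite graphs *)
Section Domination.
Variables (K : fieldType) (V : finType) (e : rel V).
Local Notation eps := (@incidence K V).
Local Notation card := (fun s : {set V} => #|s|).
Implicit Types (s t b M N B : {set V}).

Definition dominating M B : {set {set V}} :=
  [set b : {set V} | (b \subset B) && [forall u in M, [exists v in b, e u v]]].

Lemma dominatingP M B b : reflect
  (b \subset B /\ forall u, u \in M -> exists2 v, v \in b & e u v)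
  (b \in dominating M B).
Proof.
rewrite inE; apply: (iffP andP) => -[bB dom]; split=> //.
  by move=> u uM; apply/exists_inP; apply: (forall_inP dom).
by apply/forall_inP => u uM; apply/exists_inP; apply: dom.
Qed.

Lemma dominating_up M B s t : s \in dominating M B -> s \subset t -> t \subset B ->
  t \in dominating M B.
Proof.
move=> /dominatingP[_ dom] st tB; apply/dominatingP; split=> // u /dom[v vs uv].
by exists v; rewrite ?(subsetP st).
Qed.

Lemma dominating_sub M B b : b \in dominating M B -> b \subset B.
Proof. by case/dominatingP. Qed.

Lemma dominating_convex M B : convex (dominating M B).
Proof.
move=> s t u sD /dominating_sub uB st tu.
exact: dominating_up sD st (subset_trans tu uB).
Qed.

Lemma dominating_core M M' B : M' \subset M ->
  (forall u, u \in M -> exists2 u', u' \in M' & forall v, e u' v -> e u v) ->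
  dominating M B = dominating M' B.
Proof.
move=> M'M core; apply/setP => b; apply/dominatingP/dominatingP => -[bB dom];
  split=> // u uM.
  by apply: dom; apply: (subsetP M'M).
have [u' u'M' imp] := core u uM; have [v vb u'v] := dom u' u'M'.
by exists v => //; apply: imp.
Qed.

(** A dominating set with an element v outside N remains dominating when an element
    w of N with fewer neighbours than v is toggled.  The vertex w can be chosen to
    depend only on the part of the set outside N. *)
Lemma coh_poly_dominating_core M N B : N \subset B ->
  (forall v, v \in B -> exists2 w, w \in N & forall u, e u w -> e u v) ->
  coh_poly K (dominating M N) = coh_poly K (dominating M B).
Proof.
move=> NB core; pose A := [set b in dominating M B | ~~ (b \subset N)].
have -> : dominating M N = dominating M B :\: A.
  apply/setP => b; apply/idP/setDP => [bD|[bD]].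
    have bN := dominating_sub bD; split; last by rewrite inE negb_and negbK bN orbT.
    by case/dominatingP: bD => _ dom; apply/dominatingP; rewrite (subset_trans bN).
  rewrite inE bD /= negbK => bN.
  by case/dominatingP: bD => _ dom; apply/dominatingP.
apply: coh_poly_quo.
- exact: dominating_convex.
- by apply/subsetP => b /setIdP[].
- move=> s t /setIdP[sD sN] tD st; rewrite inE tD /=.
  by apply: contra sN; apply: subset_trans.
move=> k; have [->|[s0]] := set_0Vmem A; first exact: exact_at_set0.
case/setIdP => _ /subsetPn[v0 _ _].
pose p (c : {set V}) := odflt v0 [pick w in N | [exists v in c, [forall u, e u w ==> e u v]]].
have pP s : s \in A -> p (s :&: (B :\: N)) \in N /\
    exists v, [/\ v \in s, v \notin N & forall u, e u (p (s :&: (B :\: N))) -> e u v].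
  case/setIdP => /dominating_sub sB /subsetPn[v vs vN].
  have vB := subsetP sB v vs.
  rewrite /p; case: pickP => [w /andP[wN /exists_inP[v' + /forallP imp]]|no].
    rewrite !inE => /andP[v's /andP[v'N _]]; split=> //.
    by exists v'; split=> // u; apply/implyP.
  have [w wN imp] := core v vB; have /negbT := no w; rewrite wN /= => /negP[].
  apply/exists_inP; exists v; first by rewrite !inE vs vN vB.
  by apply/forallP => u; apply/implyP/imp.
have pC s : s \in A -> p (s :&: (B :\: N)) \notin B :\: N.
  by move=> sA; rewrite !inE; case: (pP s sA) => ->.
apply: (toggle_exact (C := B :\: N) (p := p)) => //.
- move=> s t u /setIdP[sD sN] /setIdP[uD uN] st tu.
  rewrite inE (dominating_convex sD uD st tu) /=.
  by apply: contra sN; apply: subset_trans.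
- move=> s sA; have [wN [v [vs vN imp]]] := pP s sA.
  case/setIdP: sA => sD sN; rewrite inE; apply/andP; split.
    apply: (dominating_up sD (subsetUr _ _)).
    by rewrite subUset sub1set (subsetP NB _ wN) (dominating_sub sD).
  by apply: contra sN; apply: subset_trans; apply: subsetUr.
move=> s sA; have [wN [v [vs vN imp]]] := pP s sA.
have vp : v != p (s :&: (B :\: N)) by apply: contraNneq vN => ->.
case/setIdP: sA => /dominatingP[sB dom] sN; rewrite inE; apply/andP; split.
  apply/dominatingP; split; first exact: subset_trans (subsetDl _ _) sB.
  move=> u /dom[x xs ux]; have [xp|xp] := eqVneq x (p (s :&: (B :\: N))).
    by exists v; rewrite ?inE ?vp //; apply: imp; rewrite -xp.
  by exists x; rewrite ?inE ?xp.
by apply/subsetPn; exists v; rewrite // inE vs inE vp.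
Qed.

(** For an independent set s, a vertex of M without neighbour in s :&: N can be
    toggled.  If there is no such vertex then s contains no vertex of M, and
    s :&: N is dominating. *)
Lemma coh_poly_independent M N : [disjoint M & N] ->
  (forall u v, u \in M :|: N -> v \in M :|: N -> e u v -> (u \in M) && (v \in N)) ->
  coh_poly K [set s : {set V} | (s \subset M :|: N) &&
            [forall u in s, forall v in s, ~~ e u v]] =
  coh_poly K (dominating M N).
Proof.
move=> MN eMN; set X := [set s | _].
have XP s : reflect (s \subset M :|: N /\ forall u v, u \in s -> v \in s -> ~~ e u v)
    (s \in X).
  rewrite inE; apply: (iffP andP) => -[sMN no]; split=> //.
    by move=> u v us; apply: (forall_inP (forall_inP no u us)).
  by apply/forall_inP => u us; apply/forall_inP => v vs; apply: no.
have X_down s t : t \in X -> s \subset t -> s \in X.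
  move=> /XP[tMN no] st; apply/XP; split; first exact: subset_trans st tMN.
  by move=> u v us vs; apply: no; apply: (subsetP st).
have DX : dominating M N \subset X.
  apply/subsetP => b /dominating_sub bN; apply/XP; split.
    exact: subset_trans bN (subsetUr _ _).
  move=> u v ub vb; apply/negP => /eMN; rewrite !inE !(subsetP bN) ?orbT //.
  by case/(_ isT isT)/andP => uM _; have := disjointFr MN uM; rewrite (subsetP bN).
have X_dom s : s \in X -> s :&: N \in dominating M N -> s \in dominating M N.
  case/XP=> sMN no /dominatingP[_ dom]; apply/dominatingP; split; last first.
    by move=> u /dom[v /setIP[vs _] uv]; exists v.
  apply/subsetP => u us; have := subsetP sMN u us; rewrite inE => /orP[uM|//].
  have [v /setIP[vs _] uv] := dom u uM.
  by have := no u v us vs; rewrite uv.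
apply/esym/coh_poly_sub => //.
- by move=> s t u _ uX _ tu; apply: X_down tu.
- move=> s t /dominatingP[sN dom] tX st; apply: X_dom tX _.
  apply/dominatingP; split; first exact: subsetIr.
  by move=> u /dom[v vs uv]; exists v; rewrite // inE (subsetP st) // (subsetP sN).
move=> k; have [->|[s0]] := set_0Vmem (X :\: dominating M N); first exact: exact_at_set0.
pose bad (c : {set V}) u := (u \in M) && [forall v in c, ~~ e u v].
have badP s : s \in X :\: dominating M N -> exists u, bad (s :&: N) u.
  case/setDP => sX sD; apply/existsP; apply: contraNT sD => /existsPn no.
  apply: X_dom => //; apply/dominatingP; split=> [|u uM]; first exact: subsetIr.
  have := no u; rewrite /bad uM /= negb_forall => /existsP[v].
  by rewrite negb_imply negbK => /andP[vs uv]; exists v.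
move=> s0X; have [u0 _] := badP _ s0X; move=> {s0X s0}.
pose p (c : {set V}) := odflt u0 [pick u | bad c u].
have pP s : s \in X :\: dominating M N -> bad (s :&: N) (p (s :&: N)).
  by move=> /badP[u su]; rewrite /p; case: pickP => [//|/(_ u)]; rewrite su.
have bad_notin s : forall u, bad (s :&: N) u -> s \notin dominating M N.
  move=> u /andP[uM /forall_inP no]; apply/dominatingP => -[sN /(_ u uM)[v vs uv]].
  by have := no v; rewrite inE vs (subsetP sN) // uv => /(_ isT).
have pN s : s \in X :\: dominating M N -> p (s :&: N) \notin N.
  by move=> /pP/andP[pM _]; rewrite (disjointFr MN pM).
apply: (toggle_exact (C := N) (p := p)) => //.
- move=> s t u /setDP[sX sD] /setDP[uX uD] st tu.
  rewrite in_setD (X_down _ _ uX tu) andbT; apply: contra uD => tD.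
  apply: X_dom uX _; apply/dominatingP; split; first exact: subsetIr.
  case/dominatingP: tD => tN dom x /dom[v vt xv].
  by exists v; rewrite // inE (subsetP tu) // (subsetP tN).
- move=> s sX; have := pP s sX; have := pN s sX; set u := p _ => uN bu.
  have tN : (u |: s) :&: N = s :&: N.
    by rewrite setIUl (_ : [set u] :&: N = set0) ?set0U //; apply/eqP; rewrite setI_eq0 disjoints1.
  rewrite in_setD (bad_notin _ u) ?tN //=; case/andP: bu => uM /forall_inP no.
  case/setDP: sX => /XP[sMN nos] _; apply/XP; split.
    by rewrite subUset sub1set inE uM.
  have uMN : u \in M :|: N by rewrite inE uM.
  move=> x y; rewrite !inE => /orP[/eqP->|xs] /orP[/eqP->|ys].
  + by apply/negP => /(eMN _ _ uMN uMN)/andP[_]; rewrite (negbTE uN).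
  + apply/negP => uy; have /andP[_ yN] := eMN _ _ uMN (subsetP sMN y ys) uy.
    by have := no y; rewrite inE ys yN uy => /(_ isT).
  + by apply/negP => /(eMN _ _ (subsetP sMN x xs) uMN)/andP[_]; rewrite (negbTE uN).
  exact: nos.
move=> s sX; have := pP s sX; have := pN s sX; set u := p _ => uN bu.
have tN : (s :\ u) :&: N = s :&: N.
  by rewrite setIDAC; apply/setDidPl; rewrite disjoint_sym disjoints1 inE negb_and uN orbT.
rewrite in_setD (bad_notin _ u) ?tN //=.
by case/setDP: sX => sX _; apply: X_down sX (subsetDl _ _).
Qed.

Lemma coh_poly_dominating_set0 B v : v \in B -> coh_poly K (dominating set0 B) = 0.
Proof.
move=> vB; apply: (@coh_poly_toggle K V _ set0 (fun=> v)).
- exact: dominating_convex.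
- by move=> s _; rewrite inE.
- move=> s sD; apply: (dominating_up sD (subsetUr _ _)).
  by rewrite subUset sub1set vB (dominating_sub sD).
move=> s /dominating_sub sB; apply/dominatingP; split=> [|u]; last by rewrite inE.
exact: subset_trans (subsetDl _ _) sB.
Qed.

End Domination.
(** * Peeling off the layers of a poset *)
Section PosetLayers.
Variables (K : fieldType) (d : Order.disp_t) (P : finPOrderType d) (n : nat).
Local Notation V := ('I_n * P)%type.
Local Notation eps := (@incidence K V).
Local Notation card := (fun s : {set V} => #|s|).
Implicit Types (A : {set P}) (R s c : {set V}) (q : P).

(** An element above q with as few elements above it as possible is maximal. *)
Lemma max_elts_above A q : q \in A -> exists2 q', q' \in max_elts A & (q <= q')%O.
Proof.
move=> qA; have q0 : (q \in A) && (q <= q)%O by rewrite qA lexx.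
case: (@arg_minnP _ q (fun y => (y \in A) && (q <= y)%O)
  (fun y => #|[set x in A | (y <= x)%O]|) q0) => y /andP[yA qy] miny.
exists y => //; rewrite inE yA; apply/forall_inP => x xA; apply/negP => yx.
have := miny x; rewrite xA (le_trans qy (ltW yx)) leqNgt => /(_ isT)/negP; apply.
apply: proper_card; apply/properP; split.
  by apply/subsetP => z; rewrite !inE => /andP[-> /(le_trans (ltW yx))].
by exists y; rewrite inE yA ?lexx //= lt_geF.
Qed.

Lemma min_elts_below A q : q \in A -> exists2 q', q' \in min_elts A & (q' <= q)%O.
Proof.
move=> qA; have q0 : (q \in A) && (q <= q)%O by rewrite qA lexx.
case: (@arg_minnP _ q (fun y => (y \in A) && (y <= q)%O)
  (fun y => #|[set x in A | (x <= y)%O]|) q0) => y /andP[yA qy] miny.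
exists y => //; rewrite inE yA; apply/forall_inP => x xA; apply/negP => xy.
have := miny x; rewrite xA (le_trans (ltW xy) qy) leqNgt => /(_ isT)/negP; apply.
apply: proper_card; apply/properP; split.
  by apply/subsetP => z; rewrite !inE => /andP[-> zx]; apply: le_trans zx (ltW xy).
by exists y; rewrite inE yA ?lexx //= lt_geF.
Qed.

Definition slice R (i : nat) : {set V} := [set v in R | nat_of_ord v.1 == i].

Definition above : rel V := fun u v => (u.2 <= v.2)%O.

Lemma mem_layer R i (v : V) : nat_of_ord v.1 = i -> (v.2 \in layer R i) = (v \in R).
Proof.
move=> vi; apply/imsetP/idP => [[w]|vR]; last by exists v; rewrite // inE vR vi eqxx.
rewrite inE => /andP[wR /eqP wi] vw; suff -> : v = w by [].
by case: v w vi wi vw {wR} => [a p] [b q] /= ai bi ->; congr (_, _); apply: val_inj; rewrite /= ai.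
Qed.

(** The independent sets of the graph of X_i, on the maximal elements of one layer
    and the minimal elements of the next one, are compared with dominating sets
    in the whole layers. *)
Lemma coh_poly_X R i :
  coh_poly K (X_complex R i) = coh_poly K (dominating above (slice R i) (slice R i.+1)).
Proof.
pose M : {set V} := [set v in slice R i | v.2 \in max_elts (layer R i)].
pose N : {set V} := [set v in slice R i.+1 | v.2 \in min_elts (layer R i.+1)].
have vertsE : X_verts R i = M :|: N.
  apply/setP => v; rewrite !inE; congr (_ || _).
    by case: eqP => [vi|_]; rewrite ?andbF //= (mem_layer R vi) andbT andbA andbb.
  by case: eqP => [vi|_]; rewrite ?andbF //= (mem_layer R vi) andbT andbA andbb.
have M1 v : v \in M -> nat_of_ord v.1 = i by case/setIdP => /setIdP[_ /eqP].
have N1 v : v \in N -> nat_of_ord v.1 = i.+1 by case/setIdP => /setIdP[_ /eqP].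
have MN : [disjoint M & N].
  rewrite disjoint_subset; apply/subsetP => v /M1 vi; apply/negP => /N1.
  by rewrite vi => /n_Sn.
have -> : X_complex R i = [set s : {set V} | (s \subset M :|: N) &&
    [forall u in s, forall v in s, ~~ X_edge i u v]].
  by apply/setP => s; rewrite !inE vertsE.
rewrite (coh_poly_independent K (e := X_edge i) MN); last first.
  move=> u v uMN vMN /and3P[/eqP ui /eqP vi _].
  move: uMN vMN; rewrite !in_setU => /orP[->|/N1]; last by rewrite ui => /n_Sn.
  by case/orP => [/M1|-> //]; rewrite vi => /esym/n_Sn.
have -> : dominating (X_edge i) M N = dominating above M N.
  apply/setP => b; apply/dominatingP/dominatingP => -[bN dom]; split=> // u uM;
    have [v vb uv] := dom u uM; exists v => //.
    by case/and3P: uv.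
  by rewrite /X_edge (M1 u uM) (N1 v (subsetP bN v vb)) !eqxx.
rewrite (@coh_poly_dominating_core K _ above M N (slice R i.+1)).
- congr (coh_poly K _); apply/esym/dominating_core.
    by apply/subsetP => v /setIdP[].
  move=> u uR; have /setIdP[uRR /eqP ui] := uR.
  have uL : u.2 \in layer R i by rewrite (mem_layer R ui).
  have [q qmax uq] := max_elts_above uL.
  have : q \in layer R i by case/setIdP: qmax.
  case/imsetP => w; rewrite inE => /andP[wR wi] qw.
  exists w; first by apply/setIdP; rewrite -qw inE wR wi.
  by move=> v; rewrite /above -qw; apply: le_trans uq.
- by apply/subsetP => v /setIdP[].
move=> v vR; have /setIdP[vRR /eqP vi] := vR.
have vL : v.2 \in layer R i.+1 by rewrite (mem_layer R vi).
have [q qmin qv] := min_elts_below vL.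
have : q \in layer R i.+1 by case/setIdP: qmin.
case/imsetP => w; rewrite inE => /andP[wR wi] qw.
exists w; first by apply/setIdP; rewrite -qw inE wR wi.
by move=> u; rewrite /above -qw => uw; apply: le_trans uw qv.
Qed.

(** The element q can be continued by a chain in c through the last m layers. *)
Fixpoint climb c (m : nat) q : bool :=
  if m is m'.+1
  then [exists v in c, [&& nat_of_ord v.1 == (n - m)%N, (q <= v.2)%O & climb c m' v.2]]
  else true.

Definition upper R m : {set V} := [set v in R | (n - m <= v.1)%N].

Lemma climb_mono c c' m q : c \subset c' -> climb c m q -> climb c' m q.
Proof.
move=> /subsetP cc'; elim: m q => //= m IH q /exists_inP[v vc /and3P[vm qv cv]].
by apply/exists_inP; exists v; rewrite ?cc' // vm qv IH.
Qed.

Lemma climb_upper R s m q : s \subset R -> climb (s :&: upper R m) m q = climb s m q.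
Proof.
move=> sR; apply/idP/idP; first by apply/climb_mono/subsetIl.
suff H k : (k <= m)%N -> climb s k q -> climb (s :&: upper R m) k q by apply: H.
elim: k q => //= k IH q km /exists_inP[v vs /and3P[vm qv cv]].
apply/exists_inP; exists v; last by rewrite vm qv IH // ltnW.
by rewrite !inE vs (subsetP sR) //= (eqP vm) leq_sub2l.
Qed.

Variable R : {set V}.

Definition gate m c : {set V} := [set v in slice R (n - m.+1) | climb c m v.2].

(** The sets of vertices in the last m layers in which every element of the
    preceding layer starts a chain. *)
Definition ladder m : {set {set V}} :=
  opening (slice R (n - m.+1)) (upper R m) (gate m).

Lemma gate_mono m (s t : {set V}) : s \subset t -> gate m s \subset gate m t.
Proof.
move=> st; apply/subsetP => v /setIdP[vR cv]; rewrite inE vR; exact: climb_mono cv.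
Qed.

Lemma slice_upper m : (m < n)%N ->
  upper R m.+1 = slice R (n - m.+1) :|: upper R m /\
  [disjoint slice R (n - m.+1) & upper R m].
Proof.
move=> mn; have e : (n - m = (n - m.+1).+1)%N by rewrite subnSK.
split.
  apply/setP => v; rewrite !inE -andb_orr e; congr (_ && _).
  by rewrite leq_eqVlt eq_sym.
rewrite disjoint_subset; apply/subsetP => v /setIdP[_ /eqP vi].
by rewrite !inE vi e ltnn andbF.
Qed.

Lemma gate_cut m s : (m < n)%N -> s \subset upper R m.+1 ->
  s :&: slice R (n - m.+1) :&: gate m (s :&: upper R m) =
  [set v in s | (nat_of_ord v.1 == n - m.+1)%N && climb s m v.2].
Proof.
move=> mn sU; have sR : s \subset R.
  by apply: subset_trans sU _; apply/subsetP => v /setIdP[].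
apply/setP => v; rewrite !inE climb_upper //.
case: (boolP (v \in s)) => //= vs; rewrite (subsetP sR v vs) /=.
by rewrite andbA andbb.
Qed.

(** A chain from layer n - m - 2 starts with a step to an element of the next layer
    that is let through by the layers behind it. *)
Lemma ladderS m : (m.+1 < n)%N ->
  ladder m.+1 = gated (slice R (n - m.+1)) (upper R m) (gate m)
    (dominating above (slice R (n - m.+2)) (slice R (n - m.+1))).
Proof.
move=> mn; have [upE _] := slice_upper (ltnW mn).
apply/setP => s; rewrite !inE -upE.
have [sU|//] := boolP (s \subset upper R m.+1); rewrite /= gate_cut ?(ltnW mn) //.
apply/subsetP/andP => [dom|[_ dom] u uR].
  split.
    apply/subsetP => v; rewrite !inE => /and3P[vs vi _]; rewrite vi andbT.
    by have := subsetP sU v vs; rewrite inE => /andP[].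
  apply/forall_inP => u uR; have := dom u uR; rewrite inE uR /=.
  case/exists_inP => v vs /and3P[vm uv cv].
  by apply/exists_inP; exists v; rewrite // inE vs vm.
rewrite inE uR /=; have /exists_inP[v + uv] := forall_inP dom u uR.
rewrite inE => /and3P[vs vm cv].
by apply/exists_inP; exists v; rewrite // vm cv andbT; apply: uv.
Qed.

Lemma coh_poly_ladder m : (m < n)%N -> coh_poly K (ladder m) =
  \prod_(n - m.+1 <= i < n.-1) coh_poly K (X_complex R i).
Proof.
elim: m => [|m IH] mn.
  rewrite subn1 big_geq // (_ : ladder 0 = [set set0]) ?coh_poly_set1 ?cards0 ?expr0 //.
  apply/setP => c; rewrite !inE (_ : upper R 0 = set0) ?subset0.
    case: eqP => //= ->; apply/subsetP => v vR; by rewrite inE vR.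
  apply/setP => v; rewrite !inE subn0; apply/negP => /andP[_].
  by rewrite leqNgt ltn_ord.
have [_ disj] := slice_upper (ltnW mn).
have e : (n - m.+1 = (n - m.+2).+1)%N by rewrite subnSK.
rewrite ladderS // coh_poly_gated //; first last.
- move=> a b; exact: dominating_up.
- move=> a; exact: dominating_sub.
- exact: gate_mono.
rewrite -/(ladder m) IH ?(ltnW mn) // e -coh_poly_X [RHS]big_ltn //.
by rewrite -subn1 -{2}(subnK mn) -addnBA // -addn1 leq_add2l.
Qed.

Definition chain_sets : {set {set V}} :=
  [set s : {set V} | (s \subset R) &&
    [exists v in s, (nat_of_ord v.1 == 0%N) && climb s n.-1 v.2]].

Lemma coh_poly_chain_sets : (0 < n)%N -> coh_poly K chain_sets =
  coh_poly K (nonempty_sets (slice R 0)) *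
  \prod_(0 <= i < n.-1) coh_poly K (X_complex R i).
Proof.
move=> n0; have nn : (n.-1 < n)%N by rewrite prednK.
have n1 : (n - n.-1.+1 = 0)%N by rewrite prednK // subnn.
have [upE disj] := slice_upper nn; rewrite n1 in upE disj.
have upR : upper R n.-1.+1 = R by apply/setP => v; rewrite !inE n1 andbT.
rewrite upR in upE.
have lad := coh_poly_ladder nn; rewrite n1 in lad.
rewrite -lad /ladder n1 -coh_poly_gated //; first last.
- exact: nonempty_sets_up.
- by move=> a; rewrite inE => /andP[].
- exact: gate_mono.
congr (coh_poly K _); apply/setP => s; rewrite !inE -upE.
case: (boolP (s \subset R)) => //= sR.
have := @gate_cut n.-1 s nn; rewrite upR n1 => -> //.
apply/exists_inP/andP => [[v vs /andP[v0 cv]]|[_ /set0Pn[v]]].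
  split; last by apply/set0Pn; exists v; rewrite inE vs v0.
  by apply/subsetP => w; rewrite !inE => /and3P[ws -> _]; rewrite (subsetP sR).
by rewrite inE => /and3P[vs v0 cv]; exists v; rewrite // v0.
Qed.

End PosetLayers.
(** * Squarefree monomials of the letterplace ideal *)
Section LetterplaceIdeal.
Variables (K : fieldType) (d : Order.disp_t) (P : finPOrderType d) (n : nat).
Local Notation V := ('I_n * P)%type.
Implicit Types (s : {set V}) (p : n.-tuple P).

Definition graph p : {set V} := [set v | v.2 == tnth p v.1].

Lemma letterplace_genE p : letterplace_gen K p = << supp_deg (graph p) >>.
Proof.
have -> : supp_deg (graph p) = \big[mmul/mone]_(i < n) ucm (i, tnth p i).
  rewrite /supp_deg (reindex_onto (fun i => (i, tnth p i)) fst) /=.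
    by apply: eq_bigl => i; rewrite inE !eqxx.
  by move=> [i q]; rewrite inE => /eqP /= <-.
rewrite /letterplace_gen; apply: esym.
apply: (big_morph (fun m : {cmonom V} => << m >> : polyring K V)) => [m1 m2|].
  by rewrite monomM mulr1.
exact: erefl.
Qed.

(** A monomial in the ideal is a multiple of one of the generators. *)
Lemma letterplace_monom s :
  letterplace (<< supp_deg s >> : polyring K V) <->
  exists2 p : n.-tuple P, sorted <=%O p & graph p \subset s.
Proof.
split=> [[c fE]|[p p_sorted ps]].
  have : (<< supp_deg s >> : polyring K V)@_(supp_deg s) != 0.
    by rewrite mcoeffUU oner_eq0.
  case: (pickP (fun p : n.-tuple P => sorted <=%O p && (graph p \subset s))).
    by move=> p /andP[p_sorted ps] _; exists p.
  move=> no; rewrite fE raddf_sum /= big1 ?eqxx // => p p_sorted.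
  rewrite letterplace_genE; apply: mcoeffMU0 => m /divides_suppP[/andP[_]].
  by rewrite msup_supp_deg; have := no p; rewrite p_sorted /= => ->.
exists (fun p' => if p' == p then << supp_deg (s :\: graph p) >> else 0).
rewrite (bigD1 p) //= eqxx letterplace_genE monomM mulr1 (supp_deg_mul ps).
rewrite big1 ?addr0 // => p' /andP[_ /negbTE->]; exact: mul0r.
Qed.

(** Position j of the list p lies in layer n - m + j. *)
Lemma climbP s m q : (m <= n)%N -> reflect
  (exists2 p : seq P, size p = m /\ path <=%O q p &
     forall i : 'I_n, (n - m <= i)%N -> (i, nth q p (i - (n - m))) \in s)
  (climb s m q).
Proof.
elim: m q => [|m IH] q mn /=.
  constructor; exists [::] => // i; rewrite subn0 leqNgt ltn_ord //.
have e : (n - m = (n - m.+1).+1)%N by rewrite subnSK.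
have idx (j : 'I_n) : (n - m <= j)%N -> (j - (n - m) < m)%N.
  by move=> jm; rewrite ltn_subLR // subnK ?(ltnW mn).
apply: (iffP exists_inP) => [[[i x] xs /and3P[/eqP /= im qx /IH]]|].
  move=> /(_ (ltnW mn))[p [pm xp] ps]; exists (x :: p); first by rewrite /= pm qx.
  move=> j; rewrite leq_eqVlt => /orP[/eqP jm|jm].
    rewrite -jm subnn /=; suff -> : j = i by [].
    by apply: val_inj; rewrite /= im jm.
  have {}jm : (n - m <= j)%N by rewrite e.
  have -> : (j - (n - m.+1) = (j - (n - m)).+1)%N by rewrite e subnSK // -e.
  by rewrite /= (set_nth_default x) ?ps // pm idx.
case=> -[|x p] [] //= [pm] /andP[qx xp] ps.
have lt : (n - m.+1 < n)%N by rewrite -e leq_subr.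
exists (Ordinal lt, x); first by have := ps (Ordinal lt); rewrite /= subnn; apply.
rewrite /= eqxx qx; apply/IH; first exact: ltnW.
exists p => // i im; have := ps i; have im' := im; rewrite e in im'.
rewrite -(subnSK im') -e => /(_ (ltnW im')) /=.
by rewrite (set_nth_default x) // pm idx.
Qed.

Lemma letterplace_chain_sets R s : (0 < n)%N -> s \in chain_sets R <->
  s \subset R /\ letterplace (<< supp_deg s >> : polyring K V).
Proof.
move=> n0; rewrite inE letterplace_monom.
have e : (n - n.-1 = 1)%N by rewrite -[X in (X - _)%N](prednK n0) subSnn.
split=> [/andP[-> /exists_inP[[i x] xs /andP[/eqP /= i0 /(climbP _ _ (leq_pred n))]]]|].
  case=> p [pn xp]; rewrite e => ps; split=> //.
  have pn' : size (x :: p) == n by rewrite /= pn prednK.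
  exists (Tuple pn') => //; apply/subsetP => -[j y]; rewrite inE /= => /eqP->.
  rewrite (tnth_nth x) /=; case: (posnP j) => [j0|j0].
    by rewrite j0 /=; suff -> : j = i by []; apply: val_inj; rewrite /= j0 i0.
  have -> : nth x (x :: p) j = nth x p (j - 1) by rewrite subn1 -{1}(prednK j0).
  exact: ps.
case=> -> [[[|x p] /= pn]] xp /subsetP ps; first by rewrite -(eqP pn) in n0.
have pj (j : 'I_n) : (j, nth x (x :: p) j) \in s.
  by apply: ps; rewrite inE /= (tnth_nth x).
apply/exists_inP; exists (Ordinal n0, x); first exact: pj (Ordinal n0).
rewrite /=; apply/(climbP _ _ (leq_pred n)); exists p.
  by rewrite -(eqP pn).
move=> j; rewrite e => j0; have := pj j.
by rewrite -[in nth _ _ j](prednK j0) /= subn1.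
Qed.

End LetterplaceIdeal.

(** * Generating functions *)
Section Assembly.
Variables (K : fieldType).
Local Notation card := (fun s : {set _} => #|s|).

Lemma tvar_neq0 : tvar != 0.
Proof. by rewrite /tvar tofrac_eq0 polyX_eq0. Qed.

Lemma tofrac_coh_poly (V : finType) (S : {set {set V}}) N :
  (forall k, (N <= k)%N -> coh_dim (@incidence K V) card S k = 0%N) ->
  tofrac (coh_poly K S) = \sum_(k < N) tvar ^+ k * (coh_dim (@incidence K V) card S k)%:R.
Proof.
move=> h0; have -> : coh_poly K S =
    \poly_(k < N) (coh_dim (@incidence K V) card S k)%:R.
  apply/polyP => k; rewrite coef_coh_poly coef_poly.
  by case: ltnP => // /h0 ->.
rewrite poly_def rmorph_sum; apply: eq_bigr => k _ /=.
by rewrite scaler_nat rmorphMn /= rmorphXn /= mulr_natr.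
Qed.

Lemma rcoh_dimE (V : finType) (X : {set {set V}}) k :
  rcoh_dim K X k = coh_dim (@incidence K V) card X k.
Proof.
have lvE j : level card X j = faces X j by [].
have cobE j : coboundary K X j = incmx (@incidence K V) (faces X j) (faces X j.+1) by [].
rewrite /coh_dim homology_dimE lvE; case: k => [|k] /=; rewrite homology_dimE cobE.
  congr (_ - _ - _)%N; rewrite mxrank0; apply/esym/eqP; rewrite -leqn0.
  apply: leq_trans (rank_leq_row _) _; rewrite leqn0 cards_eq0.
  by apply/eqP/setP => s; rewrite !inE andbF.
by rewrite belowS lvE cobE.
Qed.

Lemma rcoh_seriesE (V : finType) (X : {set {set V}}) :
  rcoh_series K X = tvar^-1 * tofrac (coh_poly K X).
Proof.
rewrite (tofrac_coh_poly (N := #|V|.+1)) => [|k Vk]; last first.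
  apply: coh_dim_level0 => s _; rewrite neq_ltn; apply/orP; left.
  exact: leq_ltn_trans (max_card _) Vk.
rewrite mulr_sumr; apply: eq_bigr => k _.
by rewrite rcoh_dimE expfzDr ?tvar_neq0 // exprN1 [RHS]mulrA [tvar^-1 * _]mulrC.
Qed.

End Assembly.

Theorem theorem3p10 (K : fieldType) (d : Order.disp_t) (P : finPOrderType d)
    (n : nat) (hn : (1 <= n)%N) (R : {set 'I_n * P}) (hR : R != set0)
    (F : mgfree_resolution (@letterplace K d P n)) :
  betti_poly F R =
  tvar ^+ n * \prod_(0 <= i < n.-1) rcoh_series K (X_complex R i).
Proof.
have memU := fun s => letterplace_chain_sets K R s hn.
pose h := coh_dim (@incidence K ('I_n * P)%type) (fun s : {set _} => #|s|) (chain_sets R).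
have h0 : h 0%N = 0%N.
  apply: coh_dim_level0 => s; rewrite inE => /andP[_ /exists_inP[v vs _]].
  by rewrite cards_eq0; apply/set0Pn; exists v.
have hbig k : (#|R|.+1 <= k)%N -> h k = 0%N.
  move=> Rk; apply: coh_dim_level0 => s; rewrite inE => /andP[sR _].
  by rewrite neq_ltn (leq_ltn_trans (subset_leq_card sR) Rk).
have -> : betti_poly F R = tofrac (coh_poly K (chain_sets R)).
  rewrite (tofrac_coh_poly hbig) big_ord_recl -[coh_dim _ _ _ _]/(h 0%N) h0 mulr0 add0r.
  rewrite [RHS](reindex_inj rev_ord_inj); apply: eq_bigr => i _ /=.
  by rewrite (betti_coh_dim F memU) // /bump /= add1n subnSK.
under eq_bigr do rewrite rcoh_seriesE.
rewrite big_split /= -rmorph_prod /= prodr_const_nat subn0 mulrA.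
have -> : tvar ^+ n * tvar^-1 ^+ n.-1 = tvar.
  by rewrite -{1}(prednK hn) exprS -mulrA -exprMn divff ?tvar_neq0 // expr1n mulr1.
rewrite coh_poly_chain_sets // rmorphM /=.
(* if the first layer is empty, the left-hand side is 0; on the right, an empty
   layer followed by a nonempty one makes a factor vanish *)
have [R0|[v vR]] := set_0Vmem (slice R 0); last by rewrite (coh_poly_nonempty K vR).
suff -> : \prod_(0 <= i < n.-1) coh_poly K (X_complex R i) = 0 by rewrite rmorph0 !mulr0.
have [v vR] := set0Pn _ hR.
have ex : exists j, slice R j != set0.
  by exists v.1; apply/set0Pn; exists v; rewrite inE vR eqxx.
case: (ex_minnP ex) => -[|j] jR jmin; first by rewrite R0 eqxx in jR.
have [w wR] := set0Pn _ jR; have jn : (j < n.-1)%N.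
  by case/setIdP: wR => _ /eqP wj; rewrite -ltnS prednK // -wj ltn_ord.
have j0 : slice R j = set0.
  by apply/eqP; apply: contraT => /jmin; rewrite ltnn.
apply/eqP; rewrite prodf_seq_eq0; apply/hasP; exists j; first by rewrite mem_index_iota.
by rewrite /= coh_poly_X j0 (coh_poly_dominating_set0 K _ wR).
Qed.
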